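(* Consider the distributed online problem and Algorithm 1 described in the context, under Assumptions 1, 2 and 3 stated there. Let $\{\tau_t\}_{t\ge 1}$ be the positive non-increasing event-triggering threshold sequence, let $\kappa\in(0,1)$ be a constant, set $\Psi_t=\sum_{s=1}^{t}\tau_s$, and let $\{x_{i,t}\}$ be the sequences generated by Algorithm 1 with $$\alpha_t=\sqrt{\frac{\Psi_t}{t}},\qquad \beta_t=\frac{1}{t^{\kappa}},\qquad \gamma_t=\frac{1}{t^{1-\kappa}},\qquad \forall t\in\mathbb{N}_+ .$$ Then, for any $T\in\mathbb{N}_+$ and any comparator sequence $y_{[T]}=(y_1,\dots,y_T)\in\mathcal{X}_T$, $$\mathrm{Net\text{-}Reg}(\{x_{i,t}\},y_{[T]})=\mathcal{O}\big(T^{\kappa}+\sqrt{\Psi_T T}+\sqrt{\Psi_T^{-1}T}\,P_T\big),$$ $$\mathrm{Net\text{-}CCV}(\{x_{i,t}\})=\mathcal{O}\big(T^{1-\kappa/2}+\sqrt[4]{\Psi_T T^{3}}\big),$$ where $P_T=\sum_{t=1}^{T-1}\|y_{t+1}-y_t\|$ is the path-length of $y_{[T]}$.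
   Context: Notation: $[n]=\{1,\dots,n\}$; $\|\cdot\|$ is the Euclidean norm (spectral norm for matrices); $\mathcal{P}_{\mathbb{X}}$ is Euclidean projection onto $\mathbb{X}$; $[\cdot]_+$ is the componentwise positive part; $\mathrm{col}(\cdot)$ is vertical concatenation; vector inequalities are componentwise. Problem. There are $n$ agents, a set $\mathbb{X}\subseteq\mathbb{R}^p$, and for each $i\in[n]$, $t\in\mathbb{N}_+$ a local loss function $f_{i,t}:\mathbb{X}\to\mathbb{R}$ and a local constraint function $g_{i,t}:\mathbb{X}\to\mathbb{R}^{m_i}$; $m=\sum_{i=1}^n m_i$. Put $f_t(x)=\frac1n\sum_{j=1}^n f_{j,t}(x)$ and $g_t(x)=\mathrm{col}(g_{1,t}(x),\dots,g_{n,t}(x))$. For each $T$ let $\mathcal{X}_T=\{(x_1,\dots,x_T): x_t\in\mathbb{X},\ g_t(x_t)\le \mathbf{0}_m\ \forall t\in[T]\}$ and $\hat{\mathcal{X}}_T=\{(x,\dots,x): x\in\mathbb{X},\ g_t(x)\le\mathbf{0}_m\ \forall t\in[T]\}$; both are assumed non-empty. Communication at time $t$ is over a directed graph $\mathcal{G}_t=([n],\mathcal{E}_t)$ with mixing matrix $W_t\in\mathbb{R}^{n\times n}$ satisfying $[W_t]_{ij}>0$ if $(j,i)\in\mathcal{E}_t$ or $i=j$, and $[W_t]_{ij}=0$ otherwise. Assumption 1. (i) $\mathbb{X}$ is convex and closed, and $\|x\|\le R(\mathbb{X})$ for all $x\in\mathbb{X}$, for a positive constant $R(\mathbb{X})$.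 (ii) All $f_{i,t}$ and $g_{i,t}$ (componentwise) are convex, and for some constant $F_1>0$: $|f_{i,t}(x)-f_{i,t}(y)|\le F_1$ and $\|g_{i,t}(x)\|\le F_1$ for all $x,y\in\mathbb{X}$, $i$, $t$. (iii) Subgradients $\partial f_{i,t}(x)\in\mathbb{R}^p$ and $\partial g_{i,t}(x)\in\mathbb{R}^{p\times m_i}$ (whose $k$-th column is a subgradient of the $k$-th component of $g_{i,t}$) exist at every $x\in\mathbb{X}$, and for some constant $F_2>0$: $\|\partial f_{i,t}(x)\|\le F_2$, $\|\partial g_{i,t}(x)\|\le F_2$ for all $x\in\mathbb{X}$, $i$, $t$. Here $\partial[g_{i,t}(x)]_+\in\mathbb{R}^{p\times m_i}$ denotes a subgradient of $x\mapsto[g_{i,t}(x)]_+$: its $k$-th column is $s_k$ times the $k$-th column of $\partial g_{i,t}(x)$, with $s_k=1$ if the $k$-th component of $g_{i,t}(x)$ is positive, $s_k=0$ if it is negative, and $s_k\in[0,1]$ if it is zero. Assumption 2. (i) There is $w\in(0,1)$ with $[W_t]_{ij}\ge w$ whenever $[W_t]_{ij}>0$. (ii) Each $W_t$ is doubly stochastic. (iii) There is an integer $B>0$ such that for all $t\in\mathbb{N}_+$ the graph $([n],\bigcup_{l=0}^{B-1}\mathcal{E}_{t+l})$ is strongly connected. Assumption 3. The threshold sequence $\{\tau_t\}$ is non-increasing. Algorithm 1 (with positive parameter sequences $\{\alpha_t\},\{\beta_t\},\{\gamma_t\},\{\tau_t\}$). Initialize $x_{i,1}\in\mathbb{X}$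 arbitrarily, $\hat x_{i,1}=x_{i,1}$, $q_{i,1}=\mathbf{0}_{m_i}$. For $t=1,2,\dots$ and each $i\in[n]$: $z_{i,t+1}=\sum_{j=1}^n[W_t]_{ij}\hat x_{j,t}$; $\omega_{i,t+1}=\partial f_{i,t}(x_{i,t})+\partial[g_{i,t}(x_{i,t})]_+\,q_{i,t}$; $x_{i,t+1}=\mathcal{P}_{\mathbb{X}}(z_{i,t+1}-\alpha_{t+1}\omega_{i,t+1})$; $q_{i,t+1}=\big[(1-\beta_{t+1}\gamma_{t+1})q_{i,t}+\gamma_{t+1}\big([g_{i,t}(x_{i,t})]_+ +(\partial[g_{i,t}(x_{i,t})]_+)^T(x_{i,t+1}-x_{i,t})\big)\big]_+$; if $\|x_{i,t+1}-\hat x_{i,t}\|\ge\tau_{t+1}$ set $\hat x_{i,t+1}=x_{i,t+1}$, else set $\hat x_{i,t+1}=\hat x_{i,t}$. Performance metrics: $\mathrm{Net\text{-}Reg}(\{x_{i,t}\},y_{[T]})=\frac1n\sum_{i=1}^n\sum_{t=1}^T f_t(x_{i,t})-\sum_{t=1}^T f_t(y_t)$ and $\mathrm{Net\text{-}CCV}(\{x_{i,t}\})=\frac1n\sum_{i=1}^n\sum_{t=1}^T\|[g_t(x_{i,t})]_+\|$. Convention: $A=\mathcal{O}(B)$ means $A\le C\,B$ for all sufficiently large $T$, where the constant $C>0$ (and the threshold on $T$) does not depend on $T$ or on the comparator sequence, but may depend on the fixed problem data and algorithm parameters. *)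

(* Defs.v *)
From HB Require Import structures.
From mathcomp Require Export all_boot all_order all_algebra.
From mathcomp Require Export all_classical all_reals all_analysis.
Set Implicit Arguments.
Unset Strict Implicit.
Unset Printing Implicit Defensive.
Import Order.TTheory GRing.Theory Num.Theory.
Import numFieldNormedType.Exports.
Local Open Scope classical_set_scope.
Local Open Scope ring_scope.

(* Time ranges over nat; every notion below only reads its time-indexed data
   at times t >= 1, so the value at index 0 is irrelevant. Functions on the
   constraint set X are total functions on R^p of which only the values on X
   are constrained. *)

Section Vectors.
Context {R : realType}.

(* The library norm `|x| of a matrix is the maximum norm, hence these. *)
Definition enorm p (x : 'cV[R]_p) : R := Num.sqrt (\sum_(k < p) x k 0 ^+ 2).

Definition specnorm p r (A : 'M[R]_(p, r)) : R :=
  sup [set enorm (A *m v) | v in [set v : 'cV[R]_r | enorm v <= 1]].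

(* For X nonempty, closed and convex the set below is a singleton. *)
Definition eproj p (X : set 'cV[R]_p) (v : 'cV[R]_p) : 'cV[R]_p :=
  xget v [set u | X u /\ forall y, X y -> enorm (v - u) <= enorm (v - y)].

Definition pospart p r (A : 'M[R]_(p, r)) : 'M[R]_(p, r) :=
  map_mx (fun a => Num.max a 0) A.

Definition vle0 p (v : 'cV[R]_p) : Prop := forall k, v k 0 <= 0.

Definition is_subgradient p (X : set 'cV[R]_p) (h : 'cV[R]_p -> R)
    (x d : 'cV[R]_p) : Prop :=
  forall y, X y -> h x + (d^T *m (y - x)) 0 0 <= h y.

(* D is a subgradient of [h]_+ at a point where h has value v and subgradient
   matrix G. *)
Definition is_pospart_subgradient p r (v : 'cV[R]_r) (G D : 'M[R]_(p, r)) : Prop :=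
  exists s : 'I_r -> R, forall k,
    [/\ 0 <= s k <= 1, 0 < v k 0 -> s k = 1, v k 0 < 0 -> s k = 0 &
        col k D = s k *: col k G].

End Vectors.

Section Problem.
Context {R : realType} {n p : nat} {m : 'I_n -> nat}.
Implicit Types (X : set 'cV[R]_p) (f : 'I_n -> nat -> 'cV[R]_p -> R)
  (g : forall i : 'I_n, nat -> 'cV[R]_p -> 'cV[R]_(m i))
  (x : 'I_n -> nat -> 'cV[R]_p) (y : nat -> 'cV[R]_p)
  (E : nat -> rel 'I_n) (W : nat -> 'M[R]_n) (T : nat).

Definition global_loss f (t : nat) (v : 'cV[R]_p) : R :=
  n%:R^-1 * \sum_(j < n) f j t v.

Definition global_constraint g (t : nat) (v : 'cV[R]_p) :
    'cV[R]_(\sum_(j < n) m j) :=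
  \mxcol_(j < n) g j t v.

(* Sequences (y_1, ..., y_T) are represented by functions on nat of which only
   the values at 1, ..., T matter. *)
Definition feasible_seqs X g T : set (nat -> 'cV[R]_p) :=
  [set y | forall t, (0 < t <= T)%N ->
     X (y t) /\ vle0 (global_constraint g t (y t))].

Definition static_feasible_seqs X g T : set (nat -> 'cV[R]_p) :=
  [set y | exists v, X v /\ forall t, (0 < t <= T)%N ->
     y t = v /\ vle0 (global_constraint g t v)].

(* The arc (j, i) belongs to the edge set at time t iff E t j i. *)
Definition mixing_matrices E W : Prop :=
  forall t, (0 < t)%N -> forall i j,
    (E t j i || (i == j) -> 0 < W t i j) /\
    (~~ (E t j i || (i == j)) -> W t i j = 0).

Definition strongly_connected (e : rel 'I_n) : Prop :=
  forall i j, connect e i j.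

Definition doubly_stochastic (A : 'M[R]_n) : Prop :=
  [/\ forall i j, 0 <= A i j,
      forall i, \sum_(j < n) A i j = 1 &
      forall j, \sum_(i < n) A i j = 1].

(* df i t, dg i t and dgp i t are the subgradients of f i t, g i t and
   [g i t]_+ to which the algorithm has access. *)
Record assumption1 X f g
    (df : 'I_n -> nat -> 'cV[R]_p -> 'cV[R]_p)
    (dg dgp : forall i : 'I_n, nat -> 'cV[R]_p -> 'M[R]_(p, m i))
    (RX F1 F2 : R) : Prop := Assumption1 {
  a1_convex : convex_set X;
  a1_closed : closed X;
  a1_RX : 0 < RX;
  a1_bounded : forall v, X v -> enorm v <= RX;
  a1_f_convex : forall i t, (0 < t)%N -> convex_function X (f i t);
  a1_g_convex : forall i t, (0 < t)%N ->
    forall k, convex_function X (fun v => g i t v k 0);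
  a1_F1 : 0 < F1;
  a1_f_bounded : forall i t, (0 < t)%N ->
    forall v v', X v -> X v' -> `|f i t v - f i t v'| <= F1;
  a1_g_bounded : forall i t, (0 < t)%N ->
    forall v, X v -> enorm (g i t v) <= F1;
  a1_df : forall i t, (0 < t)%N ->
    forall v, X v -> is_subgradient X (f i t) v (df i t v);
  a1_dg : forall i t, (0 < t)%N -> forall v, X v ->
    forall k, is_subgradient X (fun u => g i t u k 0) v (col k (dg i t v));
  a1_F2 : 0 < F2;
  a1_df_bounded : forall i t, (0 < t)%N ->
    forall v, X v -> enorm (df i t v) <= F2;
  a1_dg_bounded : forall i t, (0 < t)%N ->
    forall v, X v -> specnorm (dg i t v) <= F2;
  a1_dgp : forall i t, (0 < t)%N -> forall v, X v ->
    is_pospart_subgradient (g i t v) (dg i t v) (dgp i t v) }.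

Record assumption2 E W (w : R) (B : nat) : Prop := Assumption2 {
  a2_w : 0 < w < 1;
  a2_weights : forall t, (0 < t)%N -> forall i j, 0 < W t i j -> w <= W t i j;
  a2_stochastic : forall t, (0 < t)%N -> doubly_stochastic (W t);
  a2_B : (0 < B)%N;
  a2_connected : forall t, (0 < t)%N ->
    strongly_connected [rel a b | [exists l : 'I_B, E (t + l)%N a b]] }.

Definition assumption3 (tau : nat -> R) : Prop :=
  forall s t, (0 < s <= t)%N -> tau t <= tau s.

(* (x, xhat, z, omega, q) is a run of the algorithm. *)
Record algorithm1 X g
    (df : 'I_n -> nat -> 'cV[R]_p -> 'cV[R]_p)
    (dgp : forall i : 'I_n, nat -> 'cV[R]_p -> 'M[R]_(p, m i))
    W (alpha beta gamma tau : nat -> R)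
    (x xhat z omega : 'I_n -> nat -> 'cV[R]_p)
    (q : forall i : 'I_n, nat -> 'cV[R]_(m i)) : Prop := Algorithm1 {
  alg_x1 : forall i, X (x i 1%N);
  alg_xhat1 : forall i, xhat i 1%N = x i 1%N;
  alg_q1 : forall i, q i 1%N = 0;
  alg_z : forall i t, (0 < t)%N ->
    z i t.+1 = \sum_(j < n) W t i j *: xhat j t;
  alg_omega : forall i t, (0 < t)%N ->
    omega i t.+1 = df i t (x i t) + dgp i t (x i t) *m q i t;
  alg_x : forall i t, (0 < t)%N ->
    x i t.+1 = eproj X (z i t.+1 - alpha t.+1 *: omega i t.+1);
  alg_q : forall i t, (0 < t)%N ->
    q i t.+1 = pospart
      ((1 - beta t.+1 * gamma t.+1) *: q i t +
       gamma t.+1 *: (pospart (g i t (x i t)) +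
                      (dgp i t (x i t))^T *m (x i t.+1 - x i t)));
  alg_xhat : forall i t, (0 < t)%N ->
    xhat i t.+1 =
      if tau t.+1 <= enorm (x i t.+1 - xhat i t) then x i t.+1 else xhat i t }.

Definition net_reg f x y T : R :=
  n%:R^-1 * (\sum_(i < n) \sum_(1 <= t < T.+1) global_loss f t (x i t))
  - \sum_(1 <= t < T.+1) global_loss f t (y t).

Definition net_ccv g x T : R :=
  n%:R^-1 * \sum_(i < n) \sum_(1 <= t < T.+1)
    enorm (pospart (global_constraint g t (x i t))).

Definition path_length y T : R := \sum_(1 <= t < T) enorm (y t.+1 - y t).

End Problem.

Definition cumul {R : realType} (tau : nat -> R) (t : nat) : R :=
  \sum_(1 <= s < t.+1) tau s.

(* Main.v *)
(* Projecting onto X and convexity give, for each agent, a one-step inequality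
   in which the loss gap, the drift of the squared queue |q|^2 / (2 gamma), the
   penalty beta |q|^2 and the squared displacement |x_{t+1} - z_{t+1}|^2 /
   (2 alpha) on one side are bounded by gamma, the step length |x_{t+1} - x_t|
   and the decrease of |x - y|^2 / (2 alpha) on the other. Double stochasticity
   makes that decrease telescope when summed over the agents and over time, up
   to the event-triggering errors tau_t and the moves of the comparator.
   Every product of n B successive mixing matrices has all its entries above
   w^(n B), hence contracts the largest distance between two agents; so the
   total disagreement is controlled by the total displacement plus Psi_T, and
   the total displacement is absorbed by its squares through AM-GM. This gives
   the regret bound. Moreover the regret is at least - n F1 T, so against a
   static comparator the same inequality bounds all squared terms by O(T). Since
   the constraint violation is linear in the queues and the displacements,
   AM-GM with weights T^(-kappa/2) and (Psi_T / T)^(1/4) yields the second bound. *)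
Require Import Defs.
From mathcomp Require Import ring lra zify.
Set Implicit Arguments.
Unset Strict Implicit.
Unset Printing Implicit Defensive.
Import Order.TTheory GRing.Theory Num.Theory.
Import numFieldNormedType.Exports.
Local Open Scope classical_set_scope.
Local Open Scope ring_scope.

(** * Euclidean vectors *)

Section Euclidean.
Context {R : realType}.

Definition dot p (u v : 'cV[R]_p) : R := (u^T *m v) 0 0.

Lemma dotE p (u v : 'cV[R]_p) : dot u v = \sum_(k < p) u k 0 * v k 0.
Proof. by rewrite /dot mxE; apply: eq_bigr => k _; rewrite mxE. Qed.

Lemma dotC p (u v : 'cV[R]_p) : dot u v = dot v u.
Proof. by rewrite !dotE; apply: eq_bigr => k _; rewrite mulrC. Qed.

Lemma dotDr p (u v w : 'cV[R]_p) : dot u (v + w) = dot u v + dot u w.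
Proof. by rewrite /dot mulmxDr mxE. Qed.

Lemma dotZr p (a : R) (u v : 'cV[R]_p) : dot u (a *: v) = a * dot u v.
Proof. by rewrite /dot -scalemxAr mxE. Qed.

Lemma dotNr p (u v : 'cV[R]_p) : dot u (- v) = - dot u v.
Proof. by rewrite -scaleN1r dotZr mulN1r. Qed.

Lemma dotBr p (u v w : 'cV[R]_p) : dot u (v - w) = dot u v - dot u w.
Proof. by rewrite dotDr dotNr. Qed.

Lemma dotDl p (u v w : 'cV[R]_p) : dot (u + v) w = dot u w + dot v w.
Proof. by rewrite dotC dotDr !(dotC w). Qed.

Lemma dotZl p (a : R) (u v : 'cV[R]_p) : dot (a *: u) v = a * dot u v.
Proof. by rewrite dotC dotZr dotC. Qed.

Lemma dotNl p (u v : 'cV[R]_p) : dot (- u) v = - dot u v.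
Proof. by rewrite dotC dotNr dotC. Qed.

Lemma dotBl p (u v w : 'cV[R]_p) : dot (u - v) w = dot u w - dot v w.
Proof. by rewrite dotDl dotNl. Qed.

Lemma dot_mulmx p r (A : 'M[R]_(p, r)) (u : 'cV[R]_p) (v : 'cV[R]_r) :
  dot u (A *m v) = dot (A^T *m u) v.
Proof. by rewrite /dot trmx_mul trmxK mulmxA. Qed.

Lemma dot_ge0 p (u : 'cV[R]_p) : 0 <= dot u u.
Proof. by rewrite dotE sumr_ge0 // => k _; rewrite -expr2 sqr_ge0. Qed.

Lemma enorm_ge0 p (u : 'cV[R]_p) : 0 <= enorm u.
Proof. exact: sqrtr_ge0. Qed.

Lemma enorm_sqr p (u : 'cV[R]_p) : enorm u ^+ 2 = dot u u.
Proof.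
have e : \sum_(k < p) u k 0 ^+ 2 = dot u u.
  by rewrite dotE; apply: eq_bigr => k _; rewrite expr2.
by rewrite /enorm e sqr_sqrtr ?dot_ge0.
Qed.

Lemma enormZ p (a : R) (u : 'cV[R]_p) : enorm (a *: u) = `|a| * enorm u.
Proof.
apply/eqP; rewrite -(eqrXn2 (n := 2)) ?mulr_ge0 ?enorm_ge0 //; apply/eqP.
by rewrite exprMn !enorm_sqr dotZl dotZr real_normK ?num_real // expr2 mulrA.
Qed.

Lemma enorm0 p : enorm (0 : 'cV[R]_p) = 0.
Proof. by rewrite -(scale0r 0) enormZ normr0 mul0r. Qed.

Lemma enormN p (u : 'cV[R]_p) : enorm (- u) = enorm u.
Proof. by rewrite -scaleN1r enormZ normrN1 mul1r. Qed.

Lemma enormBC p (u v : 'cV[R]_p) : enorm (u - v) = enorm (v - u).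
Proof. by rewrite -enormN opprB. Qed.

Lemma enorm_le p r (u : 'cV[R]_p) (v : 'cV[R]_r) : dot u u <= dot v v -> enorm u <= enorm v.
Proof. by rewrite -!enorm_sqr ler_pXn2r ?nnegrE ?enorm_ge0. Qed.

Lemma enorm_sqr_le p (u : 'cV[R]_p) a : 0 <= a -> dot u u <= a ^+ 2 -> enorm u <= a.
Proof. by move=> a0; rewrite -enorm_sqr ler_pXn2r ?nnegrE ?enorm_ge0. Qed.

Lemma enorm_coord p (u : 'cV[R]_p) k : `|u k 0| <= enorm u.
Proof.
rewrite -(@ler_pXn2r _ 2) ?nnegrE ?enorm_ge0 // real_normK ?num_real //.
rewrite enorm_sqr dotE (bigD1 k) //= -expr2 lerDl sumr_ge0 // => j _.
by rewrite -expr2 sqr_ge0.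
Qed.

Lemma enorm_eq0 p (u : 'cV[R]_p) : enorm u = 0 -> u = 0.
Proof.
move=> u0; apply/matrixP => k j; rewrite ord1 mxE; apply/eqP.
by rewrite -normr_le0 -u0 enorm_coord.
Qed.

Lemma dot_le p (u v : 'cV[R]_p) : dot u v <= enorm u * enorm v.
Proof.
have [u0|u0] := eqVneq (enorm u) 0.
  by rewrite u0 mul0r (enorm_eq0 u0) -(scale0r 0) dotZl mul0r.
have [v0|v0] := eqVneq (enorm v) 0.
  by rewrite v0 mulr0 (enorm_eq0 v0) -(scale0r 0) dotZr mul0r.
have := dot_ge0 (enorm v *: u - enorm u *: v).
rewrite !(dotBl, dotBr, dotZl, dotZr) -!enorm_sqr (dotC v u).
set a := enorm u; set b := enorm v; set c := dot u v => H.
have ab : 0 < a * b by rewrite mulr_gt0 // lt_neqAle eq_sym enorm_ge0 ?u0 ?v0.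
by rewrite -(ler_pM2l ab); lra.
Qed.

Lemma enormD_sqr p (u v : 'cV[R]_p) :
  enorm (u + v) ^+ 2 = enorm u ^+ 2 + 2 * dot u v + enorm v ^+ 2.
Proof. by rewrite !enorm_sqr !(dotDl, dotDr) (dotC v u); ring. Qed.

Lemma enormB_sqr p (u v : 'cV[R]_p) :
  enorm (u - v) ^+ 2 = enorm u ^+ 2 - 2 * dot u v + enorm v ^+ 2.
Proof. by rewrite enormD_sqr dotNr enormN; ring. Qed.

Lemma enormD p (u v : 'cV[R]_p) : enorm (u + v) <= enorm u + enorm v.
Proof.
rewrite -(@ler_pXn2r _ 2) ?nnegrE ?addr_ge0 ?enorm_ge0 // enormD_sqr.
by have := dot_le u v; nra.
Qed.

Lemma enormB p (u v : 'cV[R]_p) : enorm (u - v) <= enorm u + enorm v.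
Proof. by rewrite -(enormN v) enormD. Qed.

Lemma enorm_sum p (I : Type) (r : seq I) (P : pred I) (F : I -> 'cV[R]_p) :
  enorm (\sum_(i <- r | P i) F i) <= \sum_(i <- r | P i) enorm (F i).
Proof.
elim/big_rec2: _ => [|i a u _ le]; first by rewrite enorm0.
by apply: le_trans (enormD _ _) _; rewrite lerD2l.
Qed.

Lemma enorm_triangle p (v u w : 'cV[R]_p) : enorm (u - w) <= enorm (u - v) + enorm (v - w).
Proof. by rewrite -{1}(subrK v u) -addrA enormD. Qed.

Lemma enorm_le_l1 p (u : 'cV[R]_p) : enorm u <= \sum_k `|u k 0|.
Proof.
apply: enorm_sqr_le; first exact: sumr_ge0.
rewrite dotE expr2 mulr_suml ler_sum // => k _.
rewrite -expr2 -real_normK ?num_real // expr2 ler_wpM2l //.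
by rewrite (bigD1 k) //= lerDl sumr_ge0.
Qed.

Lemma enorm_mono p (u v : 'cV[R]_p) : (forall k, `|u k 0| <= `|v k 0|) -> enorm u <= enorm v.
Proof.
move=> le; apply: enorm_le; rewrite !dotE ler_sum // => k _.
by rewrite -!expr2 -[u k 0 ^+ 2]real_normK ?num_real // -[v k 0 ^+ 2]real_normK ?num_real // ler_pXn2r ?nnegrE.
Qed.

(** The supremum defining [specnorm] bounds its members only if the set is bounded above; the sum of
    the absolute entries of [A] is such a bound. Normalising [v] then gives the inequality. *)
Lemma enorm_mulmx_le p r (A : 'M[R]_(p, r)) (v : 'cV[R]_r) :
  enorm (A *m v) <= specnorm A * enorm v.
Proof.
have ub : has_ubound [set enorm (A *m v) | v in [set v : 'cV[R]_r | enorm v <= 1]].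
  exists (\sum_k \sum_l `|A k l|) => _ [u /= u1 <-].
  apply: le_trans (enorm_le_l1 _) _; apply: ler_sum => k _.
  rewrite mxE; apply: le_trans (ler_norm_sum _ _ _) _; apply: ler_sum => l _.
  by rewrite normrM ler_piMr // (le_trans (enorm_coord u l)).
have [v0|v0] := eqVneq (enorm v) 0.
  rewrite v0 (enorm_eq0 v0).
  by rewrite mulmx0 enorm0 mulr0.
have v1 : 0 < enorm v by rewrite lt_neqAle eq_sym v0 enorm_ge0.
have /(ub_le_sup ub) : [set enorm (A *m v) | v in [set v : 'cV[R]_r | enorm v <= 1]]
    (enorm (A *m ((enorm v)^-1 *: v))).
  exists ((enorm v)^-1 *: v) => //=.
  by rewrite enormZ ger0_norm ?invr_ge0 ?enorm_ge0 // mulVf.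
by rewrite -scalemxAr enormZ ger0_norm ?invr_ge0 ?enorm_ge0 // ler_pdivrMl // mulrC.
Qed.

(** With v = A^T u one has |v|^2 = <u, A v> <= |u| F |v|; divide by |v|. The queue update multiplies
    by the transposed subgradient matrix, whereas the assumption bounds the matrix itself. *)
Lemma enorm_mulmx_tr p r (A : 'M[R]_(p, r)) (F : R) : 0 <= F ->
  (forall v, enorm (A *m v) <= F * enorm v) ->
  forall u, enorm (A^T *m u) <= F * enorm u.
Proof.
move=> F0 AF u; set v := A^T *m u.
have [v0|v0] := eqVneq (enorm v) 0; first by rewrite v0 mulr_ge0 ?enorm_ge0.
have v1 : 0 < enorm v by rewrite lt_neqAle eq_sym v0 enorm_ge0.
rewrite -(ler_pM2l v1) -expr2 enorm_sqr {1}/v -dot_mulmx.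
apply: le_trans (dot_le _ _) _.
have := AF v; have := enorm_ge0 u; nra.
Qed.

End Euclidean.

(** * Projection and positive part *)

Section Projection.
Context {R : realType} {p : nat}.
Implicit Types (X : set 'cV[R]_p) (u v y : 'cV[R]_p).

(** The set is a closed subset of the transpose of a cube of row vectors, which is compact as a
    product of segments. *)
Lemma compact_closed_bounded X (M : R) :
  closed X -> (forall v, X v -> enorm v <= M) -> compact X.
Proof.
move=> Xcl XM.
pose K := [set v : 'rV[R]_p | forall i, `[- M, M]%classic (v ord0 i)].
have Kco : compact K.
  by apply: (@rV_compact R p (fun=> `[- M, M]%classic)) => i; exact: segment_compact.
have trc : continuous (fun v : 'rV[R]_p => v^T : 'cV[R]_p).
  move=> v s /= /(nbhs_ballP (v^T)) [e e0 es].
  apply/nbhs_ballP; exists e => //= w vw; apply: es.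
  by case: vw => e0' vw; split=> // i j; rewrite !mxE; exact: vw.
have KTco : compact ((fun v : 'rV[R]_p => v^T : 'cV[R]_p) @` K).
  by apply: continuous_compact => //; exact: continuous_subspaceT.
apply: (subclosed_compact Xcl KTco) => v Xv; exists v^T; last exact: trmxK.
move=> i /=; rewrite mxE in_itv/= -ler_norml.
by apply: le_trans (enorm_coord v i) _; exact: XM.
Qed.

Lemma continuous_enormB v : continuous (fun u : 'cV[R]_p => enorm (v - u)).
Proof.
move=> u; rewrite /enorm.
apply: (@continuous_comp _ _ _ (fun u => \sum_(k < p) (v - u) k 0 ^+ 2) Num.sqrt); last exact: sqrt_continuous.
have Fu : Filter (nbhs u) by exact: nbhs_filter.
apply: cvg_big => [|k _]; first exact: add_continuous.
rewrite (_ : (fun u => _) = (fun u : 'cV[R]_p => (v k 0 - u k 0) ^+ 2)); last first.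
  by apply/funext => u'; rewrite !mxE.
rewrite !mxE.
apply: (@continuous_comp _ _ _ (fun u : 'cV[R]_p => v k 0 - u k 0) (fun a => a ^+ 2)); last exact: exprn_continuous.
by apply: (@cvgB R R^o _ (nbhs u) Fu); [exact: cvg_cst | exact: coord_continuous].
Qed.

(** The extreme value theorem provides a minimiser, so [xget] returns one instead of its default
    [v]. *)
Lemma eproj_min X (M : R) v : X !=set0 -> closed X -> (forall v, X v -> enorm v <= M) ->
  X (eproj X v) /\ forall y, X y -> enorm (v - eproj X v) <= enorm (v - y).
Proof.
move=> X0 Xcl XM.
have [|c cX cmin] := compact_EVT_min X0 (compact_closed_bounded Xcl XM) (f := fun u => enorm (v - u)).
  exact/continuous_subspaceT/continuous_enormB.
rewrite /eproj; case: xgetP => [u -> []//|/(_ c) []]; split; first exact/set_mem.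
by move=> y Xy; apply: cmin; exact/mem_set.
Qed.

Lemma convex_set_mem X u v (t : R) : convex_set X -> X u -> X v ->
  0 <= t -> t <= 1 -> X (u + t *: (v - u)).
Proof.
move=> Xc Xu Xv t0 t1; have := Xc v u (Itv01 t0 t1) (mem_set Xv) (mem_set Xu).
move/set_mem; congr X.
by rewrite /conv/= scalerBr /unstable.onem scalerBl scale1r addrCA.
Qed.

(** Moving from the projection u towards y by a fraction t stays in X and cannot reduce the distance
    to v, whence 2 c <= t b for every t in (0, 1]. *)
Lemma eproj_variational X (M : R) v y : convex_set X -> closed X ->
  (forall v, X v -> enorm v <= M) -> X y ->
  dot (v - eproj X v) (y - eproj X v) <= 0.
Proof.
move=> Xc Xcl XM Xy.
have [|Xu umin] := @eproj_min X M v _ Xcl XM; first by exists y.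
set u := eproj X v in Xu umin *.
set c := dot _ _; set b := enorm (y - u) ^+ 2.
have le t : 0 < t -> t <= 1 -> 2 * c <= t * b.
  move=> t0 t1; have := umin _ (convex_set_mem Xc Xu Xy (ltW t0) t1).
  rewrite -(@ler_pXn2r _ 2) ?nnegrE ?enorm_ge0 // opprD addrA.
  rewrite (enormB_sqr (v - u)) enormZ exprMn dotZr -/c -/b real_normK ?num_real // => H.
  by rewrite -(ler_pM2l t0); lra.
have b0 : 0 <= b by rewrite sqr_ge0.
case: (lerP c 0) => // c0.
have bc : 0 < b + c by lra.
(* Instead of letting t tend to 0, take t = c / (b + c): then t b <= c, which contradicts 2 c <= t b
   when c > 0. *)
have := le (c / (b + c)); rewrite divr_gt0 // ler_pdivrMr // => /(_ isT).
have -> : c / (b + c) * b = c * (b / (b + c)) by ring.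
have : b / (b + c) <= 1 by rewrite ler_pdivrMr //; lra.
by move=> h /(_ ltac:(lra)); nra.
Qed.

Lemma eproj_three_point X (M : R) v y : convex_set X -> closed X ->
  (forall v, X v -> enorm v <= M) -> X y ->
  enorm (eproj X v - y) ^+ 2 <= enorm (v - y) ^+ 2 - enorm (v - eproj X v) ^+ 2.
Proof.
move=> Xc Xcl XM Xy; have := eproj_variational v Xc Xcl XM Xy.
set u := eproj X v => H.
have -> : v - y = (v - u) - (y - u) by rewrite opprB addrA subrK.
by rewrite (enormB_sqr (v - u)) (enormBC u); lra.
Qed.

End Projection.

(** * Norms of positive parts and of stacked vectors *)

Section PositivePart.
Context {R : realType}.

Lemma pospart_mono p (u v : 'cV[R]_p) : (forall k, pospart u k 0 <= `|v k 0|) ->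
  enorm (pospart u) <= enorm v.
Proof.
move=> le; apply: enorm_mono => k.
by rewrite ger0_norm ?le // mxE le_max lexx orbT.
Qed.

Lemma enorm_pospart p (u : 'cV[R]_p) : enorm (pospart u) <= enorm u.
Proof. by apply: pospart_mono => k; rewrite mxE ge_max ler_norm normr_ge0. Qed.

Lemma pospart_ge0 p r (u : 'M[R]_(p, r)) k j : 0 <= pospart u k j.
Proof. by rewrite mxE le_max lexx orbT. Qed.

Lemma pospart_ge p r (u : 'M[R]_(p, r)) k j : u k j <= pospart u k j.
Proof. by rewrite mxE le_max lexx. Qed.

(** The squared norm of a stacked vector is the sum of the squared block norms, at most the square
    of their sum. *)
Lemma enorm_pospart_mxcol n (m : 'I_n -> nat) (v : forall i, 'cV[R]_(m i)) :
  enorm (pospart (\mxcol_(i < n) v i)) <= \sum_(i < n) enorm (pospart (v i)).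
Proof.
have -> : pospart (\mxcol_(i < n) v i) = \mxcol_(i < n) pospart (v i).
  by apply/matrixP => k j; rewrite !mxE.
apply: enorm_sqr_le; first by rewrite sumr_ge0 // => i _; exact: enorm_ge0.
rewrite /dot tr_mxcol mul_mxrow_mxcol summxE expr2 mulr_suml ler_sum // => i _.
rewrite -[leLHS]/(dot (pospart (v i)) (pospart (v i))) -enorm_sqr expr2 ler_wpM2l ?enorm_ge0 //.
by rewrite (bigD1 i) //= lerDl sumr_ge0 // => j _; exact: enorm_ge0.
Qed.

Lemma vle0_mxcol n (m : 'I_n -> nat) (v : forall i, 'cV[R]_(m i)) i :
  vle0 (\mxcol_(i < n) v i) -> vle0 (v i).
Proof.
by move=> le k; rewrite -(mxcolK v i) mxE; exact: le.
Qed.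

End PositivePart.

(** * Consensus *)

Section ShiftedSums.
Context {R : realDomainType} (a : nat -> R) (M : R).

Lemma sum_shift1 l T : \sum_(1 <= t < T.+1) a (t.+1 + l)%N =
  \sum_(1 <= t < T.+1) a (t + l)%N + (a (T.+1 + l)%N - a (1 + l)%N).
Proof.
apply/eqP; rewrite -subr_eq0 opprD addrA -sumrB.
by rewrite (telescope_sumr (fun i => a (i + l)%N)) // subrr.
Qed.

Hypothesis a_bounded : forall t, (0 < t)%N -> 0 <= a t <= M.

(** Each unit shift trades one boundary term for another, both in [0, M], so it costs at most M. *)
Lemma sum_shift_le l T :
  \sum_(1 <= t < T.+1) a (t + l)%N <= \sum_(1 <= t < T.+1) a t + l%:R * M.
Proof.
elim: l => [|l IH]; first by under eq_bigr do rewrite addn0; rewrite mul0r addr0.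
apply: (@le_trans _ _ (\sum_(1 <= t < T.+1) a (t + l)%N + M)); last first.
  by rewrite -natr1; lra.
under eq_bigr do rewrite addnS -addSn.
rewrite -[leLHS]addr0 -lerBlDl.
rewrite sum_shift1.
have /andP[_ ?] := @a_bounded (T.+1 + l) isT.
have /andP[? _] := @a_bounded (1 + l) isT.
lra.
Qed.

Lemma sum_le_shift l T :
  \sum_(1 <= t < T.+1) a t <= \sum_(1 <= t < T.+1) a (t + l)%N + l%:R * M.
Proof.
elim: l => [|l IH]; first by under [in leRHS]eq_bigr do rewrite addn0; rewrite mul0r addr0.
apply: le_trans IH _; rewrite -natr1.
suff : \sum_(1 <= t < T.+1) a (t + l)%N <= \sum_(1 <= t < T.+1) a (t + l.+1)%N + M by lra.
under [in leRHS]eq_bigr do rewrite addnS -addSn.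
rewrite sum_shift1.
have /andP[? _] := @a_bounded (T.+1 + l) isT.
have /andP[_ ?] := @a_bounded (1 + l) isT.
lra.
Qed.

End ShiftedSums.

(** * Diameter of a family of vectors and its contraction by averaging *)

Section Diameter.
Context {R : realType} {n p : nat}.
Implicit Types (x y : 'I_n -> 'cV[R]_p) (A : 'M[R]_n).

Definition diam x : R := \big[Num.max/0]_(ij : 'I_n * 'I_n) enorm (x ij.1 - x ij.2).

Definition mix A x (i : 'I_n) : 'cV[R]_p := \sum_(j < n) A i j *: x j.

Lemma diam_ge x i j : enorm (x i - x j) <= diam x.
Proof. by apply: (le_bigmax _ (fun ij => enorm (x ij.1 - x ij.2)) (i, j)). Qed.

Lemma diam_ge0 x : 0 <= diam x.
Proof.
rewrite /diam; elim/big_ind: _ => // [a b a0 b0|ij _]; last exact: enorm_ge0.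
by rewrite le_max a0.
Qed.

Lemma diam_le x d : 0 <= d -> (forall i j, enorm (x i - x j) <= d) -> diam x <= d.
Proof. by move=> d0 le; apply: bigmax_le => // -[i j] _; exact: le. Qed.

Lemma diamD x y : diam (fun i => x i + y i) <= diam x + diam y.
Proof.
apply: diam_le => [|i j]; first by rewrite addr_ge0 ?diam_ge0.
by rewrite opprD addrACA (le_trans (enormD _ _)) // lerD ?diam_ge.
Qed.

Lemma mixD A x y i : mix A (fun i => x i + y i) i = mix A x i + mix A y i.
Proof. by rewrite -big_split /=; apply: eq_bigr => j _; rewrite scalerDr. Qed.

Lemma mix_mulmx A A' x i : mix (A *m A') x i = mix A (mix A' x) i.
Proof.
rewrite /mix; under [RHS]eq_bigr do rewrite scaler_sumr.
rewrite exchange_big; apply: eq_bigr => j _ /=.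
by rewrite mxE scaler_suml; apply: eq_bigr => k _; rewrite scalerA.
Qed.

(** The difference of two averages is the double average of x_l - x_l' with weights A_il A_kl'. The
    pair (l0, l0) contributes nothing although its weight is at least eta^2, so at most 1 - eta^2 of
    the diameter remains. *)
Lemma diam_mix A (eta : R) x : (0 < n)%N -> 0 <= eta ->
  (forall i j, eta <= A i j) -> (forall i, \sum_(j < n) A i j = 1) ->
  diam (mix A x) <= (1 - eta ^+ 2) * diam x.
Proof.
move=> n_gt0 eta0 Aeta A1; pose l0 := Ordinal n_gt0.
have A0 i j : 0 <= A i j by apply: le_trans (Aeta i j).
have key i k : enorm (mix A x i - mix A x k) <= (1 - eta ^+ 2) * diam x.
  have -> : mix A x i - mix A x k =
      \sum_(l < n) \sum_(l' < n) (A i l * A k l') *: (x l - x l').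
    under eq_bigr do (under eq_bigr do rewrite scalerBr; rewrite sumrB).
    rewrite sumrB; congr (_ - _).
      by apply: eq_bigr => l _; rewrite -scaler_suml -mulr_sumr A1 mulr1.
    rewrite exchange_big; apply: eq_bigr => l _.
    by rewrite -scaler_suml -mulr_suml A1 mul1r.
  have le1 : enorm (\sum_(l < n) \sum_(l' < n) (A i l * A k l') *: (x l - x l'))
      <= \sum_(l < n) \sum_(l' < n) A i l * A k l' * enorm (x l - x l').
    apply: le_trans (enorm_sum _ _ _) _; apply: ler_sum => l _.
    apply: le_trans (enorm_sum _ _ _) _; apply: ler_sum => l' _.
    by rewrite enormZ ger0_norm ?mulr_ge0.
  apply: le_trans le1 _.
  have AA : \sum_(l < n) \sum_(l' < n) A i l * A k l' * diam x = diam x.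
    under eq_bigr do rewrite -mulr_suml -mulr_sumr A1 mulr1.
    by rewrite -mulr_suml A1 mul1r.
  rewrite mulrBl mul1r -{1}AA lerBrDl -lerBrDr -sumrB.
  under eq_bigr do rewrite -sumrB.
  have ge0 l l' : 0 <= A i l * A k l' * diam x - A i l * A k l' * enorm (x l - x l').
    by rewrite -mulrBr !mulr_ge0 // subr_ge0 diam_ge.
  rewrite (bigD1 l0) //= (bigD1 l0) //= subrr enorm0 mulr0 subr0 -addrA.
  apply: le_trans (_ : A i l0 * A k l0 * diam x <= _).
    by rewrite ler_wpM2r ?diam_ge0 // expr2 ler_pM.
  by rewrite lerDl addr_ge0 // ?sumr_ge0 // => l _; rewrite sumr_ge0.
(* [diam_le] also asks for a nonnegative bound; [key] at a single agent gives this without comparing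
   eta with 1. *)
apply: diam_le => //.
by apply: le_trans (key l0 l0); exact: enorm_ge0.
Qed.

End Diameter.

(** A path that starts in S and ends outside it has an arc crossing the boundary. *)
Lemma connect_exit (T : finType) (e : rel T) (S : {set T}) a b :
  connect e a b -> a \in S -> b \notin S ->
  exists c d, [/\ e c d, c \in S & d \notin S].
Proof.
move=> /connectP[s]; elim: s a => [|c s IH] a /=.
  by move=> _ -> ->.
move=> /andP[eac pcs] eb aS bS.
by have [cS|cS] := boolP (c \in S); [exact: IH pcs eb cS bS | exists a, c].
Qed.

(** * Products of mixing matrices and perturbed averaging *)

Section Consensus.
Context {R : realType} {n p : nat}.
Variables (E : nat -> rel 'I_n) (W : nat -> 'M[R]_n) (w : R) (B : nat).
Hypotheses (n_gt0 : (0 < n)%N) (mixing : mixing_matrices E W) (A2 : assumption2 E W w B).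

(** The product W(t+k-1) ... W(t), latest matrix on the left, which carries the state at time t to
    time t+k. *)
Fixpoint transition (t k : nat) : 'M[R]_n :=
  if k is k'.+1 then W (t + k')%N *m transition t k' else 1%:M.

Lemma transition_ge0 t k i j : (0 < t)%N -> 0 <= transition t k i j.
Proof.
move=> t0; elim: k i j => [|k IH] i j /=; first by rewrite mxE ler0n.
rewrite mxE sumr_ge0 // => l _; rewrite mulr_ge0 //.
by have [] := a2_stochastic A2 (t := t + k) ltac:(lia).
Qed.

Lemma transition_sum t k i : (0 < t)%N -> \sum_(j < n) transition t k i j = 1.
Proof.
move=> t0; elim: k i => [|k IH] i /=.
  rewrite (bigD1 i) //= mxE eqxx big1 ?addr0 // => j; rewrite mxE eq_sym.
  by case: eqP.
under eq_bigr do rewrite mxE.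
rewrite exchange_big /=; under eq_bigr do rewrite -mulr_sumr IH mulr1.
by have [] := a2_stochastic A2 (t := t + k) ltac:(lia).
Qed.

Section Reach.
Variables (t : nat) (j : 'I_n).
Hypothesis t_gt0 : (0 < t)%N.

(** The agents on which the value held by [j] at time [t] has weight at least w^k after k steps.
    Lowering the threshold with k lets membership propagate along arcs: each step costs one factor
    w. *)
Definition reached k := [set i | w ^+ k <= transition t k i j]%SET.

Let w01 : 0 < w < 1 := a2_w A2.

Lemma reached_step k a b : E (t + k)%N a b || (b == a) -> a \in reached k ->
  b \in reached k.+1.
Proof.
rewrite !inE => Eab le; rewrite [transition _ _]/= mxE (bigD1 a) //=.
apply: le_trans (_ : W (t + k)%N b a * transition t k a j <= _); last first.
  rewrite lerDl sumr_ge0 // => l _; rewrite mulr_ge0 ?transition_ge0 //.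
  by have [] := a2_stochastic A2 (t := t + k) ltac:(lia).
rewrite exprS ler_pM ?exprn_ge0 //; try by case/andP: w01 => /ltW.
apply: (a2_weights A2); first by lia.
by have [+ _] := @mixing (t + k)%N ltac:(lia) b a; apply.
Qed.

Lemma reached_mono k l : reached k \subset reached (k + l).
Proof.
elim: l => [|l IH]; first by rewrite addn0.
apply: fintype.subset_trans IH _; rewrite addnS; apply/fintype.subsetP => i.
by apply: reached_step; rewrite eqxx orbT.
Qed.

(** Over a window of length B the union of the graphs is strongly connected, so some arc, active at
    time t+k+l, leaves [reached k]. Self-loops keep its tail reached until then, so its head is
    reached one step later and stays so until the end of the window. *)
Lemma reached_grow k : reached k != [set: 'I_n]%SET -> (#|reached k| < #|reached (k + B)|)%N.
Proof.
move=> neT; apply: proper_card; rewrite properE reached_mono /=.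
have [b bS] : exists b, b \notin reached k.
  by apply/existsP; rewrite -negb_forall; apply: contra neT => /forallP h; apply/eqP/setP => i; rewrite h inE.
have jS : j \in reached k.
  by apply: (fintype.subsetP (reached_mono 0 k)); rewrite inE /= mxE eqxx expr0.
have := a2_connected A2 (t := t + k) ltac:(lia) j b.
move=> /connect_exit/(_ jS bS)[c [d [/= /existsP[l Ecd] cS dS]]].
apply/fintype.subsetPn; exists d => //.
have : d \in reached (k + l).+1.
  apply: (@reached_step _ c); first by rewrite addnA Ecd.
  exact: (fintype.subsetP (reached_mono _ _)).
apply: fintype.subsetP; have -> : (k + B = (k + l).+1 + (B - l.+1))%N.
  by have := ltn_ord l; lia.
exact: reached_mono.
Qed.

(** Starting from [j] alone, every window of length B adds an agent until all are reached. After n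
    windows a set that is not full would have more than n elements. *)
Lemma reached_all : reached (n * B) = [set: 'I_n]%SET.
Proof.
have key k : reached (k * B) = [set: 'I_n]%SET \/ (k < #|reached (k * B)|)%N.
  elim: k => [|k IH].
    right; apply/card_gt0P; exists j.
    by rewrite inE mul0n /= mxE eqxx expr0.
  rewrite mulSn addnC.
  have [full|nfull] := eqVneq (reached (k * B)) [set: 'I_n]%SET.
    left; apply/eqP; rewrite finset.eqEsubset finset.subsetT /=.
    by rewrite -{1}full reached_mono.
  right; have := reached_grow nfull.
  by case: IH => [h|]; [rewrite h eqxx in nfull | lia].
case: (key n) => // h; exfalso.
by have := leq_trans h (max_card _); rewrite card_ord ltnn.
Qed.

End Reach.

Lemma transition_ge t i j : (0 < t)%N -> w ^+ (n * B) <= transition t (n * B) i j.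
Proof.
move=> t0; have : i \in [set: 'I_n]%SET by rewrite inE.
by rewrite -(reached_all j t0) inE.
Qed.

Section Perturbed.
Variables (x r : nat -> 'I_n -> 'cV[R]_p).
Hypothesis x_rec : forall t i, (0 < t)%N -> x t.+1 i = mix (W t) (x t) i + r t i.

(** Unrolling the recursion gives x(t+k) = transition x(t) + s, where s collects the perturbations.
    Averaging does not enlarge the diameter of s, while all entries of the full window product are
    at least w^(nB), so it contracts the first term. *)
Lemma diam_window t : (0 < t)%N ->
  diam (x (t + n * B)%N) <=
    (1 - (w ^+ (n * B)) ^+ 2) * diam (x t) + \sum_(l < n * B) diam (r (t + l)%N).
Proof.
move=> t0.
have key k : exists2 s : 'I_n -> 'cV[R]_p,
    forall i, x (t + k)%N i = mix (transition t k) (x t) i + s i &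
    diam s <= \sum_(l < k) diam (r (t + l)%N).
  elim: k => [|k [s xE sd]].
    exists (fun=> 0) => [i|].
      rewrite addn0 addr0 /mix (bigD1 i) //= mxE eqxx scale1r big1 ?addr0 // => j ji.
      by rewrite mxE eq_sym (negbTE ji) scale0r.
    by rewrite big_ord0 diam_le // => i j; rewrite subrr enorm0.
  exists (fun i => mix (W (t + k)%N) s i + r (t + k)%N i) => [i|].
    rewrite addnS x_rec; last by lia.
    rewrite /= addrA mix_mulmx; congr (_ + _).
    by rewrite -mixD; apply: eq_bigr => j _; rewrite xE.
  apply: le_trans (diamD _ _) _; rewrite big_ord_recr /= lerD2r.
  apply: le_trans sd; rewrite -[leRHS]mul1r -[X in X * _](subr0 1).
  have [W0 W1 _] := a2_stochastic A2 (t := t + k) ltac:(lia).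
  (* With eta = 0 the contraction lemma says that averaging by a row-stochastic matrix is
     nonexpansive. *)
  by have := @diam_mix _ _ _ (W (t + k)%N) 0 s n_gt0 (lexx 0) W0 W1; rewrite expr0n.
have [s xE sd] := key (n * B)%N.
have -> : x (t + n * B)%N = (fun i => mix (transition t (n * B)) (x t) i + s i).
  exact/funext.
apply: le_trans (diamD _ _) _; apply: lerD => //.
apply: diam_mix => // [|i j|i]; last exact: transition_sum.
  by rewrite exprn_ge0 //; case/andP: (a2_w A2) => /ltW.
exact: transition_ge.
Qed.

(** Let S and Q be the sums of the diameters of x and r, and L = nB. Summing the window inequality
    over t and undoing the shifts gives eta^2 S <= L M + L Q + L^2 M, which is at most (L + L^2)(M +
    Q). *)
Lemma sum_diam_le (M : R) T :
  (forall t, (0 < t)%N -> diam (x t) <= M) -> (forall t, (0 < t)%N -> diam (r t) <= M) ->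
  \sum_(1 <= t < T.+1) diam (x t) <=
    ((n * B)%:R + (n * B)%:R ^+ 2) / (w ^+ (n * B)) ^+ 2 *
    (M + \sum_(1 <= t < T.+1) diam (r t)).
Proof.
move=> xM rM; set L := (n * B)%N; set eta := w ^+ L.
have eta0 : 0 < eta by rewrite exprn_gt0 //; case/andP: (a2_w A2).
have xb t : (0 < t)%N -> 0 <= diam (x t) <= M by move=> t0; rewrite diam_ge0 xM.
have rb t : (0 < t)%N -> 0 <= diam (r t) <= M by move=> t0; rewrite diam_ge0 rM.
have M0 : 0 <= M by apply: le_trans (diam_ge0 (x 1%N)) (xM _ _).
have H1 := sum_le_shift xb L T.
have H2 : \sum_(1 <= t < T.+1) diam (x (t + L)%N) <=
    (1 - eta ^+ 2) * \sum_(1 <= t < T.+1) diam (x t) +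
    \sum_(1 <= t < T.+1) \sum_(l < L) diam (r (t + l)%N).
  rewrite mulr_sumr -big_split /= big_nat [leRHS]big_nat ler_sum // => t /andP[t0 _].
  exact: diam_window.
have H3 : \sum_(1 <= t < T.+1) \sum_(l < L) diam (r (t + l)%N) <=
    L%:R * (\sum_(1 <= t < T.+1) diam (r t) + L%:R * M).
  rewrite exchange_big /=.
  apply: le_trans (_ : \sum_(l < L) (\sum_(1 <= t < T.+1) diam (r t) + L%:R * M) <= _).
    apply: ler_sum => l _; apply: le_trans (sum_shift_le rb l T) _.
    by rewrite lerD2l ler_wpM2r // ler_nat ltnW.
  by rewrite sumr_const card_ord [leRHS]mulr_natl.
have r0 : 0 <= \sum_(1 <= t < T.+1) diam (r t).
  by rewrite sumr_ge0 // => t _; exact: diam_ge0.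
rewrite mulrAC ler_pdivlMr; last exact: exprn_gt0.
set S := \sum_(_ <= _ < _) diam (x _) in H1 H2 *.
set Q := \sum_(_ <= _ < _) diam (r _) in H3 r0 *.
have : 0 <= L%:R ^+ 2 * Q by rewrite mulr_ge0 // sqr_ge0.
by lra.
Qed.

End Perturbed.
End Consensus.

(** * Step sizes and their sums *)

Section Sequences.
Context {R : realType}.

(** Convexity of exp between ln u and 0, with weights k and 1 - k; u = 0 is treated apart because ln
    is then meaningless. *)
Lemma powR_bernoulli (k u : R) : 0 <= k -> k <= 1 -> 0 <= u -> u `^ k <= 1 + k * (u - 1).
Proof.
move=> k0 k1 u0.
have [->|kn0] := eqVneq k 0; first by rewrite powRr0; lra.
have [->|un0] := eqVneq u 0; first by rewrite powR0 //; lra.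
have := convex_expR (Itv01 k0 k1) (ln u) 0.
rewrite !convRE /= mulr0 addr0 expR0 lnK ?posrE; last by rewrite lt_neqAle eq_sym un0.
by rewrite /powR (negbTE un0) /unstable.onem; lra.
Qed.

(** Bernoulli's inequality at u = t / (t+1), multiplied by (t+1)^k. Summed, it compares the sum of
    t^(k-1) with a telescoping sum. *)
Lemma powR_increment (k : R) t : 0 < k -> k <= 1 ->
  k * t.+1%:R `^ (k - 1) <= t.+1%:R `^ k - t%:R `^ k.
Proof.
move=> k0 k1; set s : R := t.+1%:R.
have s0 : 0 < s by rewrite ltr0n.
have tE : t%:R = s * (t%:R / s) by rewrite mulrC divfK // gt_eqF.
rewrite tE powRM ?divr_ge0 // ?(ltW s0) //.
have := @powR_bernoulli k (t%:R / s) (ltW k0) k1 ltac:(by rewrite divr_ge0 // ltW).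
have -> : t%:R / s - 1 = - s^-1.
  rewrite (_ : t%:R = s - 1); last by rewrite /s -natr1 addrK.
  by rewrite mulrBl mul1r divff ?gt_eqF // addrAC subrr add0r.
move=> H.
rewrite -(mulr_powRB1 (ltW s0) k0).
have p0 := powR_ge0 s (k - 1).
have : s * s `^ (k - 1) * (t%:R / s) `^ k <= s * s `^ (k - 1) * (1 + k * - s^-1).
  by rewrite ler_wpM2l // mulr_ge0 // ltW.
have -> : s * s `^ (k - 1) * (1 + k * - s^-1) = s * s `^ (k - 1) - k * s `^ (k - 1).
  by field; rewrite gt_eqF.
by lra.
Qed.

Lemma sum_powR (k : R) T : 0 < k -> k <= 1 ->
  \sum_(1 <= t < T.+1) t.+1%:R `^ (k - 1) <= k^-1 * T.+1%:R `^ k.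
Proof.
move=> k0 k1; rewrite -ler_pdivrMl ?invr_gt0 // invrK mulr_sumr.
apply: le_trans (_ : \sum_(1 <= t < T.+1) (t.+1%:R `^ k - t%:R `^ k) <= _).
  by apply: ler_sum => t _; exact: powR_increment.
rewrite telescope_sumr // lerBlDr lerDl; exact: powR_ge0.
Qed.

Lemma powR_double (k : R) T : 0 <= k -> k <= 1 -> (0 < T)%N ->
  T.+1%:R `^ k <= 2 * T%:R `^ k.
Proof.
move=> k0 k1 T0; apply: le_trans (_ : (2 * T%:R) `^ k <= _).
  by apply: ge0_ler_powR => //; rewrite ?nnegrE // -natrM ler_nat; lia.
rewrite powRM // ler_wpM2r ?powR_ge0 // ler1_powR //; lra.
Qed.

(** * Step sizes built from the average threshold *)

Variable tau : nat -> R.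
Hypotheses (tau_noninc : assumption3 tau) (tau_gt0 : forall t, (0 < t)%N -> 0 < tau t).
Local Notation Psi := (cumul tau).
Local Notation alpha := (fun t : nat => Num.sqrt (Psi t / t%:R)).

Lemma cumulS t : Psi t.+1 = Psi t + tau t.+1.
Proof. by rewrite /cumul big_nat_recr. Qed.

Lemma cumul_ge0 t : 0 <= Psi t.
Proof. by rewrite /cumul big_nat sumr_ge0 // => s /andP[s0 _]; rewrite ltW ?tau_gt0. Qed.

Lemma cumul_le s t : (s <= t)%N -> Psi s <= Psi t.
Proof.
move=> st; rewrite -(subnKC st); elim: (t - s)%N => [|k IH]; first by rewrite addn0.
by rewrite addnS cumulS (le_trans IH) // lerDl ltW ?tau_gt0.
Qed.

Lemma cumul1 : Psi 1 = tau 1%N. Proof. by rewrite /cumul big_nat1. Qed.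

Lemma cumul_ge_tau1 t : (0 < t)%N -> tau 1%N <= Psi t.
Proof. by move=> t0; rewrite -cumul1 cumul_le. Qed.

Lemma cumul_gt0 t : (0 < t)%N -> 0 < Psi t.
Proof. by move=> t0; apply: lt_le_trans (cumul_ge_tau1 t0); exact: tau_gt0. Qed.

Lemma cumul_ub t : Psi t <= tau 1%N * t%:R.
Proof.
apply: le_trans (_ : \sum_(1 <= s < t.+1) tau 1%N <= _).
  by rewrite /cumul big_nat [leRHS]big_nat ler_sum // => s /andP[s0 _]; apply: tau_noninc.
by rewrite sumr_const_nat subSS subn0 mulr_natr.
Qed.

Lemma cumul_lb t : (0 < t)%N -> t%:R * tau t <= Psi t.
Proof.
move=> t0; apply: le_trans (_ : \sum_(1 <= s < t.+1) tau t <= _).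
  by rewrite sumr_const_nat subSS subn0 mulr_natl.
rewrite /cumul big_nat [leRHS]big_nat ler_sum // => s /andP[s0 st].
by apply: tau_noninc; rewrite s0.
Qed.

Lemma alpha_gt0 t : (0 < t)%N -> 0 < alpha t.
Proof. by move=> t0; rewrite sqrtr_gt0 divr_gt0 ?cumul_gt0 // ltr0n. Qed.

Lemma alpha_noninc t : (0 < t)%N -> alpha t.+1 <= alpha t.
Proof.
move=> t0; rewrite ler_wsqrtr // ler_pdivrMr ?ltr0n // mulrAC ler_pdivlMr ?ltr0n //.
rewrite cumulS -natr1 mulrDl mulrDr mulr1 lerD2l mulrC.
apply: le_trans (cumul_lb t0); rewrite ler_wpM2l //.
by apply: tau_noninc; rewrite t0 /=.
Qed.

(** Induction on T. With a, b the roots of Psi_T, Psi_{T+1} and c, d those of T, T+1, the step is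
    2ac + b/d <= 2bd, which follows from a <= b and 2cd <= c^2 + d^2 = 2d^2 - 1. *)
Lemma sum_alpha T :
  \sum_(1 <= t < T.+1) alpha t.+1 <= 2 * Num.sqrt (Psi T * T%:R).
Proof.
elim: T => [|T IH]; first by rewrite big_geq // mulr_ge0 ?sqrtr_ge0.
rewrite big_nat_recr //=; apply: le_trans (lerD IH (alpha_noninc (ltn0Sn T))) _.
rewrite !sqrtrM ?cumul_ge0 // sqrtrV //.
have := ler_wsqrtr (cumul_le (leqnSn T)).
set a := Num.sqrt (Psi T); set b := Num.sqrt (Psi T.+1) => ab.
have c0 := sqrtr_ge0 (T%:R : R); have d0 : 0 < Num.sqrt (T.+1%:R : R) by rewrite sqrtr_gt0 ltr0n.
have cE : Num.sqrt (T%:R : R) ^+ 2 = T%:R by rewrite sqr_sqrtr.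
have dE : Num.sqrt (T.+1%:R : R) ^+ 2 = T%:R + 1 by rewrite sqr_sqrtr // natr1.
move: c0 d0 cE dE; set c := Num.sqrt (T%:R); set d := Num.sqrt _ => c0 d0 cE dE.
have a0 : 0 <= a by exact: sqrtr_ge0.
rewrite -(ler_pM2r d0) mulrDl -mulrA [b / d * d]divfK ?gt_eqF //.
have : 2 * (c * d) + 1 <= 2 * d ^+ 2 by have := sqr_ge0 (c - d); rewrite sqrrB; lra.
have : a * (c * d) <= b * (c * d) by rewrite ler_wpM2r // mulr_ge0 // ltW.
by nra.
Qed.

(** The discrete form of integrating dPsi / sqrt(Psi): with a, b the successive roots, (b^2 - a^2) /
    b <= 2 (b - a). *)
Lemma sum_tau_sqrt T : \sum_(1 <= t < T.+1) tau t / Num.sqrt (Psi t) <= 2 * Num.sqrt (Psi T).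
Proof.
elim: T => [|T IH]; first by rewrite big_geq // mulr_ge0 ?sqrtr_ge0.
rewrite big_nat_recr //=; apply: le_trans (lerD IH (lexx _)) _.
have b0 : 0 < Num.sqrt (Psi T.+1) by rewrite sqrtr_gt0 cumul_gt0.
rewrite -(ler_pM2r b0) mulrDl divfK ?gt_eqF //.
have -> : tau T.+1 = Psi T.+1 - Psi T by rewrite cumulS addrAC subrr add0r.
have := sqr_sqrtr (cumul_ge0 T); have := sqr_sqrtr (cumul_ge0 T.+1).
set a := Num.sqrt (Psi T); set b := Num.sqrt (Psi T.+1) => bE aE.
by have := sqr_ge0 (a - b); rewrite sqrrB; nra.
Qed.

Lemma sqrt_double T : (0 < T)%N -> Num.sqrt (T.+1%:R : R) <= 2 * Num.sqrt (T%:R : R).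
Proof.
by move=> T0; have := @powR_double 2^-1 T ltac:(lra) ltac:(lra) T0; rewrite !powR12_sqrt.
Qed.

Lemma alpha_inv_le t T : (t <= T)%N -> (0 < T)%N -> (0 < t)%N ->
  (alpha t.+1)^-1 <= 2 * Num.sqrt (T%:R) / Num.sqrt (Psi t).
Proof.
move=> tT T0 t0; rewrite -sqrtrV ?divr_ge0 ?cumul_ge0 // invf_div sqrtrM // sqrtrV ?cumul_ge0 //.
rewrite ler_pM ?sqrtr_ge0 ?invr_ge0 ?sqrtr_ge0 //.
  by apply: le_trans (sqrt_double T0); rewrite ler_wsqrtr // ler_nat ltnS.
by rewrite lef_pV2 ?posrE ?sqrtr_gt0 ?cumul_gt0 // ler_wsqrtr // cumul_le.
Qed.

Lemma sum_tau_alpha T :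
  \sum_(1 <= t < T.+1) tau t / alpha t.+1 <= 4 * Num.sqrt (Psi T * T%:R).
Proof.
case: T => [|T]; first by rewrite big_geq // mulr_ge0 ?sqrtr_ge0.
apply: le_trans (_ : \sum_(1 <= t < T.+2) 2 * Num.sqrt (T.+1%:R) * (tau t / Num.sqrt (Psi t)) <= _).
  rewrite big_nat [leRHS]big_nat ler_sum // => t /andP[t0 tT].
  by rewrite mulrCA ler_pM2l ?tau_gt0 // alpha_inv_le.
rewrite -mulr_sumr sqrtrM ?cumul_ge0 //.
have := sum_tau_sqrt T.+1; have := sqrtr_ge0 (T.+1%:R : R); nra.
Qed.

Lemma alpha_inv_last T : (0 < T)%N -> (alpha T.+1)^-1 <= 2 * Num.sqrt ((Psi T)^-1 * T%:R).
Proof.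
move=> T0; apply: le_trans (alpha_inv_le (leqnn T) T0 T0) _.
by rewrite sqrtrM ?invr_ge0 ?cumul_ge0 // sqrtrV ?cumul_ge0 // -mulrA (mulrC (Num.sqrt _)).
Qed.

(** Holds because Psi_T >= tau_1. It moves the part of the sqrt(T / Psi_T) term that does not
    involve the path length into sqrt(Psi_T T). *)
Lemma sqrt_inv_cumul_le T : (0 < T)%N ->
  Num.sqrt ((Psi T)^-1 * T%:R) <= (tau 1%N)^-1 * Num.sqrt (Psi T * T%:R).
Proof.
move=> T0; have P0 := cumul_gt0 T0.
rewrite !sqrtrM ?invr_ge0 ?cumul_ge0 // sqrtrV ?cumul_ge0 // mulrA ler_wpM2r ?sqrtr_ge0 //.
have b0 : 0 < Num.sqrt (Psi T) by rewrite sqrtr_gt0.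
rewrite -(ler_pM2r b0) mulVf ?gt_eqF // -mulrA -expr2 sqr_sqrtr ?cumul_ge0 //.
by rewrite ler_pdivlMl ?tau_gt0 // mulr1 cumul_ge_tau1.
Qed.

Lemma cumul_le_sqrt T : Psi T <= Num.sqrt (tau 1%N) * Num.sqrt (Psi T * T%:R).
Proof.
rewrite -{1}(sqr_sqrtr (cumul_ge0 T)) expr2 sqrtrM ?cumul_ge0 // mulrCA -[in leRHS]sqrtrM; last by rewrite ltW ?tau_gt0.
by rewrite ler_wpM2l ?sqrtr_ge0 // ler_wsqrtr // cumul_ub.
Qed.

End Sequences.

(** * Step sizes that are inverse powers of time *)

Section InversePowers.
Context {R : realType}.
Implicit Types (k : R) (t T : nat).

Lemma nat_powR_ge1 k t : 0 <= k -> (0 < t)%N -> 1 <= (t%:R : R) `^ k.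
Proof.
move=> k0 t0; apply: le_trans (_ : t%:R `^ 0 <= _); first by rewrite powRr0.
by apply: ler_powR => //; rewrite ler1n.
Qed.

Lemma nat_powR_gt0 k t : (0 < t)%N -> 0 < (t%:R : R) `^ k.
Proof. by move=> t0; rewrite powR_gt0 // ltr0n. Qed.

Lemma nat_powR_nondec k t : 0 <= k -> (t%:R : R) `^ k <= t.+1%:R `^ k.
Proof. by move=> k0; apply: ge0_ler_powR => //; rewrite ?nnegrE // ler_nat. Qed.

Lemma inv_powR_gt0 k t : (0 < t)%N -> 0 < 1 / (t%:R : R) `^ k.
Proof. by move=> t0; rewrite divr_gt0 // nat_powR_gt0. Qed.

Lemma inv_powR_noninc k t : 0 <= k -> (0 < t)%N ->
  1 / (t.+1%:R : R) `^ k <= 1 / t%:R `^ k.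
Proof.
by move=> k0 t0; rewrite !div1r lef_pV2 ?posrE ?nat_powR_gt0 // nat_powR_nondec.
Qed.

Lemma inv_powR_le1 k t : 0 <= k -> (0 < t)%N -> 1 / (t%:R : R) `^ k <= 1.
Proof. by move=> k0 t0; rewrite div1r invf_le1 ?nat_powR_gt0 // nat_powR_ge1. Qed.

(** Write s^(1-k) as s / s^k and use t / (t+1)^k <= t / t^k. For the chosen steps this says that
    1/gamma grows by at most beta per step. *)
Lemma powR_increment_le k t : 0 <= k -> k <= 1 -> (0 < t)%N ->
  (t.+1%:R : R) `^ (1 - k) - t%:R `^ (1 - k) <= 1 / t.+1%:R `^ k.
Proof.
move=> k0 k1 t0; rewrite !powRB; try by rewrite pnatr_eq0 -?lt0n ?t0 ?implybT.
rewrite !powRr1 //.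
have a0 := nat_powR_gt0 k t0; have b0 := nat_powR_gt0 k (ltn0Sn t).
have ab := nat_powR_nondec t k0.
have : t%:R / t.+1%:R `^ k <= t%:R / t%:R `^ k.
  by rewrite ler_wpM2l // lef_pV2.
by rewrite -natr1; lra.
Qed.

Lemma sum_inv_powR k T : 0 <= k -> k < 1 -> (0 < T)%N ->
  \sum_(1 <= t < T.+1) 1 / (t.+1%:R : R) `^ k <= 2 / (1 - k) * T%:R `^ (1 - k).
Proof.
move=> k0 k1 T0; apply: le_trans (_ : (1 - k)^-1 * T.+1%:R `^ (1 - k) <= _).
  apply: le_trans (sum_powR T _ _); [|lra|lra].
  apply: ler_sum => t _; rewrite div1r -powRN.
  by rewrite (_ : 1 - k - 1 = - k) // addrAC subrr add0r.
rewrite [2 / _]mulrC -mulrA ler_pM2l ?invr_gt0 ?subr_gt0 //.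
by apply: powR_double => //; lra.
Qed.

End InversePowers.

(** * One run of the algorithm *)

Section Averages.
Context {R : realType} {n p : nat} (a : 'I_n -> R).
Hypotheses (a_ge0 : forall j, 0 <= a j) (a_sum : \sum_(j < n) a j = 1).

Lemma enorm_avg_le (v : 'I_n -> 'cV[R]_p) c :
  (forall j, enorm (v j) <= c) -> enorm (\sum_(j < n) a j *: v j) <= c.
Proof.
move=> vc; apply: le_trans (enorm_sum _ _ _) _.
rewrite -[c]mul1r -a_sum mulr_suml; apply: ler_sum => j _.
by rewrite enormZ ger0_norm // ler_wpM2l.
Qed.

(** Jensen for the squared norm: average 2 <v_j, u> <= |v_j|^2 + |u|^2, where u is the average
    itself. *)
Lemma enorm_avg_sqr (v : 'I_n -> 'cV[R]_p) :
  enorm (\sum_(j < n) a j *: v j) ^+ 2 <= \sum_(j < n) a j * enorm (v j) ^+ 2.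
Proof.
set u := \sum_(j < n) _.
have dot_u : dot u u = \sum_(j < n) a j * dot (v j) u.
  have dot_sum (F : 'I_n -> 'cV[R]_p) : dot (\sum_j F j) u = \sum_j dot (F j) u.
    by apply: (big_morph (fun w => dot w u)) => [w w'|]; rewrite ?dotDl // -(scale0r 0) dotZl mul0r.
  by rewrite {1}/u dot_sum; apply: eq_bigr => j _; rewrite dotZl.
have : 2 * dot u u <= \sum_(j < n) a j * enorm (v j) ^+ 2 + dot u u.
  have -> : \sum_(j < n) a j * enorm (v j) ^+ 2 + dot u u =
      \sum_(j < n) a j * (enorm (v j) ^+ 2 + dot u u).
    by under [RHS]eq_bigr do rewrite mulrDr; rewrite big_split /= -mulr_suml a_sum mul1r.
  rewrite {1}dot_u mulr_sumr; apply: ler_sum => j _; rewrite mulrCA ler_wpM2l //.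
  have := dot_ge0 (v j - u); rewrite enorm_sqr !(dotBl, dotBr) (dotC u (v j)); lra.
by rewrite enorm_sqr; lra.
Qed.

Lemma avg_subr (v : 'I_n -> 'cV[R]_p) u :
  \sum_(j < n) a j *: v j - u = \sum_(j < n) a j *: (v j - u).
Proof.
under [RHS]eq_bigr do rewrite scalerBr.
by rewrite sumrB -scaler_suml a_sum scale1r.
Qed.

End Averages.

(** Summation by parts with nondecreasing weights. Here A t is the squared distance of the current
    iterate to the current comparator, A' t that of the next iterate to the same comparator, and
    delta t pays for moving the comparator. Each weight increase is charged to the uniform bound
    M. *)
Lemma sum_abel_le (R : realDomainType) (a A A' delta : nat -> R) (M : R) T :
  (0 < T)%N ->
  (forall t, (0 < t)%N -> 0 <= a t) -> (forall t, (0 < t)%N -> a t <= a t.+1) ->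
  (forall t, 0 <= delta t) ->
  (forall t, (0 < t <= T)%N -> A t <= M /\ A' t <= M) ->
  (forall t, (0 < t < T)%N -> A t.+1 <= A' t + delta t) ->
  \sum_(1 <= t < T.+1) a t * (A t - A' t) + a T * A' T <=
    a T * (M + \sum_(1 <= t < T) delta t).
Proof.
move=> T0 a0 a_nd delta0 AM Anext.
have key k : (k < T)%N -> \sum_(1 <= t < k.+2) a t * (A t - A' t) + a k.+1 * A' k.+1 <=
    a k.+1 * (M + \sum_(1 <= t < k.+1) delta t).
  elim: k => [|k IH] kT.
    rewrite big_nat1 big_geq // addr0 -mulrDr subrK ler_wpM2l ?a0 //.
    by case: (AM 1%N T0).
  rewrite big_nat_recr //= [in leRHS]big_nat_recr //=.
  have IHk := IH (ltnW kT); have [_ A'M] := AM k.+1 ltac:(lia).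
  have A_le : a k.+2 * A k.+2 <= a k.+2 * (A' k.+1 + delta k.+1).
    by rewrite ler_wpM2l ?a0 //; apply: Anext; lia.
  have D0 : 0 <= \sum_(1 <= t < k.+1) delta t by rewrite sumr_ge0.
  have : 0 <= (a k.+2 - a k.+1) * (M + \sum_(1 <= t < k.+1) delta t - A' k.+1).
    by rewrite mulr_ge0 ?subr_ge0 ?a_nd //; lra.
  by lra.
by case: T T0 {AM Anext} key => // T _ key; exact: key.
Qed.

Lemma le_scaled_sqr (R : realFieldType) (l a : R) : 0 < l -> a <= l * a ^+ 2 + (4 * l)^-1.
Proof.
move=> l0; have : 0 <= (4 * l)^-1 * (2 * l * a - 1) ^+ 2.
  by rewrite mulr_ge0 ?sqr_ge0 // invr_ge0 mulr_ge0 // ltW.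
have -> : (4 * l)^-1 * (2 * l * a - 1) ^+ 2 = l * a ^+ 2 + (4 * l)^-1 - a.
  by field; rewrite gt_eqF.
by rewrite subr_ge0.
Qed.

(** * Subgradients of the positive part *)

Section PospartSubgradient.
Context {R : realType} {p r : nat} (v : 'cV[R]_r) (G D : 'M[R]_(p, r)).
Hypothesis GD : is_pospart_subgradient v G D.

Lemma pospart_subgradient_norm (F : R) u : specnorm G <= F -> enorm (D *m u) <= F * enorm u.
Proof.
move=> GF; have [s sP] := GD.
have -> : D *m u = G *m (\col_k (s k * u k 0)).
  apply/matrixP => i j; rewrite ord1 !mxE; apply: eq_bigr => k _.
  have [_ _ _ /matrixP/(_ i 0)] := sP k; rewrite !mxE => ->.
  by rewrite mulrCA mulrA.
(* Nonnegativity of the supremum comes from testing on the all-ones vector. Its norm vanishes only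
   for r = 0, where the set is {0}. *)
have F0 : 0 <= specnorm G.
  have := enorm_mulmx_le G (const_mx 1); have := enorm_ge0 (G *m const_mx 1).
  have [u0|u0] := eqVneq (enorm (const_mx 1 : 'cV[R]_r)) 0; last first.
    move=> h1 h2; have := le_trans h1 h2; rewrite pmulr_lge0 //.
    by rewrite lt_neqAle eq_sym u0 enorm_ge0.
  move=> _ _; apply: ub_le_sup; last by exists 0; rewrite ?mulmx0 /= enorm0 //.
  exists 0 => _ [u' /= _ <-].
  have -> : u' = 0.
    apply/matrixP => k j; have := enorm_coord (const_mx 1 : 'cV[R]_r) k.
    by rewrite u0 mxE normr1 ler10.
  by rewrite mulmx0 enorm0.
apply: le_trans (enorm_mulmx_le _ _) _; apply: ler_pM => //; first exact: enorm_ge0.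
apply: enorm_mono => k; rewrite mxE normrM; have [/andP[s0 s1] _ _ _] := sP k.
by rewrite ger0_norm // ler_piMl.
Qed.

(** Split on the sign of v_k: the factor s_k is 0 or 1 away from zero, and at v_k = 0 any s_k in
    [0, 1] satisfies s_k c <= max(c, 0). *)
Lemma pospart_subgradient_le (v' : 'cV[R]_r) (u : 'cV[R]_p) k :
  v k 0 + ((col k G)^T *m u) 0 0 <= v' k 0 ->
  pospart v k 0 + (D^T *m u) k 0 <= pospart v' k 0.
Proof.
have [s /(_ k)[/andP[s0 s1] sp sn /matrixP sD]] := GD.
have -> : (D^T *m u) k 0 = s k * ((col k G)^T *m u) 0 0.
  rewrite !mxE mulr_sumr; apply: eq_bigr => l _; rewrite !mxE.
  by have := sD l 0; rewrite !mxE => ->; rewrite mulrA.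
set c := ((col k G)^T *m u) 0 0; rewrite !mxE => le.
case: (ltgtP (v k 0) 0) => v0.
- by rewrite sn // mul0r addr0 le_max lexx orbT.
- by rewrite sp // mul1r le_max le.
- rewrite v0 add0r in le *; rewrite le_max; have [c0|c0] := lerP 0 c.
    by apply/orP; left; nra.
  by apply/orP; right; nra.
Qed.

End PospartSubgradient.

Definition disagreement (R : realType) n p (x : 'I_n -> nat -> 'cV[R]_p) (t : nat) : R :=
  diam (fun i => x i t).

Definition displacement (R : realType) n p (x z : 'I_n -> nat -> 'cV[R]_p) (i : 'I_n) (t : nat) : R :=
  enorm (x i t.+1 - z i t.+1).

Definition consensus_const (R : realType) (n B : nat) (w : R) : R :=
  ((n * B)%:R + (n * B)%:R ^+ 2) / (w ^+ (n * B)) ^+ 2.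

(** * Inequalities along a run with general step sizes *)

Section Run.
Context (R : realType) (n p : nat) (m : 'I_n -> nat) (X : set 'cV[R]_p)
  (f : 'I_n -> nat -> 'cV[R]_p -> R)
  (g : forall i : 'I_n, nat -> 'cV[R]_p -> 'cV[R]_(m i))
  (df : 'I_n -> nat -> 'cV[R]_p -> 'cV[R]_p)
  (dg dgp : forall i : 'I_n, nat -> 'cV[R]_p -> 'M[R]_(p, m i))
  (E : nat -> rel 'I_n) (W : nat -> 'M[R]_n)
  (RX F1 F2 w : R) (B : nat) (alpha beta gamma tau : nat -> R).
Hypotheses (n_gt0 : (0 < n)%N) (mixing : mixing_matrices E W)
  (A1 : assumption1 X f g df dg dgp RX F1 F2) (A2 : assumption2 E W w B)
  (A3 : assumption3 tau) (tau_gt0 : forall t : nat, (0 < t)%N -> 0 < tau t).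
Hypotheses (alpha_gt0 : forall t, (0 < t)%N -> 0 < alpha t)
  (alpha_noninc : forall t, (0 < t)%N -> alpha t.+1 <= alpha t)
  (beta_gt0 : forall t, (0 < t)%N -> 0 < beta t)
  (beta_noninc : forall t, (0 < t)%N -> beta t.+1 <= beta t)
  (gamma_gt0 : forall t, (0 < t)%N -> 0 < gamma t)
  (beta_gamma : forall t, (0 < t)%N -> beta t * gamma t <= 1)
  (gamma_inv : forall t, (0 < t)%N -> (gamma t.+1)^-1 - (gamma t)^-1 <= beta t.+1).
Hypothesis gamma_noninc : forall t, (0 < t)%N -> gamma t.+1 <= gamma t.
Context (x xhat z omega : 'I_n -> nat -> 'cV[R]_p) (q : forall i : 'I_n, nat -> 'cV[R]_(m i)).
Hypothesis alg : algorithm1 X g df dgp W alpha beta gamma tau x xhat z omega q.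

Let F2_ge0 : 0 <= F2. Proof. exact/ltW/(a1_F2 A1). Qed.

Lemma x_mem i t : (0 < t)%N -> X (x i t).
Proof.
case: t => // -[_|t _]; first exact: (alg_x1 alg).
rewrite (alg_x alg) //.
have X0 : X !=set0 by exists (x i 1%N); exact: (alg_x1 alg).
by have [] := eproj_min (z i t.+2 - alpha t.+2 *: omega i t.+2) X0 (a1_closed A1) (a1_bounded A1).
Qed.

Lemma xhat_mem i t : (0 < t)%N -> X (xhat i t).
Proof.
elim: t => // -[_ _|t IH _]; first by rewrite (alg_xhat1 alg); exact: x_mem.
by rewrite (alg_xhat alg) //; case: ifP => _; [exact: x_mem | exact: IH].
Qed.

(** Either the trigger fired and the broadcast value is exact, or it did not and the gap is below
    the threshold. *)
Lemma xhat_near i t : (0 < t)%N -> enorm (xhat i t - x i t) <= tau t.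
Proof.
case: t => // -[_|t _].
  by rewrite (alg_xhat1 alg) subrr enorm0 ltW ?tau_gt0.
rewrite (alg_xhat alg) //; case: ifPn => [_|].
  by rewrite subrr enorm0 ltW ?tau_gt0.
by rewrite -ltNge enormBC => /ltW.
Qed.

Lemma dist_le u v : X u -> X v -> enorm (u - v) <= 2 * RX.
Proof.
move=> Xu Xv; apply: le_trans (enormB _ _) _.
by have := a1_bounded A1 Xu; have := a1_bounded A1 Xv; lra.
Qed.

(** Expanding the square, the cross term costs 4 RX |u - v| and the last square 2 RX |u - v|, since
    X has diameter at most 2 RX. *)
Lemma sqr_dist_shift u v y : X u -> X v -> X y ->
  enorm (u - y) ^+ 2 <= enorm (v - y) ^+ 2 + 6 * RX * enorm (u - v).
Proof.
move=> Xu Xv Xy; have -> : u - y = (v - y) + (u - v) by rewrite [RHS]addrC addrA subrK.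
rewrite enormD_sqr; have := dot_le (v - y) (u - v).
have := dist_le Xv Xy; have := dist_le Xu Xv.
have := enorm_ge0 (u - v); have := enorm_ge0 (v - y); have := a1_RX A1.
by nra.
Qed.

Let D i t := dgp i t (x i t).
(** The input of the queue: the positive part of the constraint linearised at x_t and evaluated at
    x_{t+1}. [Gb] bounds its norm. *)
Let b i t := pospart (g i t (x i t)) + (D i t)^T *m (x i t.+1 - x i t).
Local Notation Gb := (F1 + 2 * F2 * RX).

Lemma dgp_tr_norm i t v u : (0 < t)%N -> X v -> enorm ((dgp i t v)^T *m u) <= F2 * enorm u.
Proof.
move=> t0 Xv; apply: enorm_mulmx_tr => // u'.
apply: (pospart_subgradient_norm (a1_dgp A1 _ t0 Xv)).
exact: (a1_dg_bounded A1).
Qed.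

Lemma dgp_le i t v y k : (0 < t)%N -> X v -> X y ->
  pospart (g i t v) k 0 + ((dgp i t v)^T *m (y - v)) k 0 <= pospart (g i t y) k 0.
Proof.
move=> t0 Xv Xy; apply: (pospart_subgradient_le (a1_dgp A1 _ t0 Xv)).
have := a1_dg A1 t0 Xv k Xy; exact.
Qed.

Lemma b_norm i t : (0 < t)%N -> enorm (b i t) <= Gb.
Proof.
move=> t0; apply: le_trans (enormD _ _) _; apply: lerD.
  exact: le_trans (enorm_pospart _) (a1_g_bounded A1 _ t0 (x_mem i t0)).
apply: le_trans (dgp_tr_norm _ _ t0 (x_mem i t0)) _; rewrite -(mulrA 2) mulrCA.
by rewrite ler_wpM2l // dist_le //; exact: x_mem.
Qed.

Lemma q_ge0 i t k : (0 < t)%N -> 0 <= q i t k 0.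
Proof.
case: t => // -[_|t _]; first by rewrite (alg_q1 alg) mxE.
rewrite (alg_q alg) //; exact: pospart_ge0.
Qed.

Let Gb_ge0 : 0 <= Gb.
Proof. by have := a1_F1 A1; have := a1_RX A1; have := F2_ge0; nra. Qed.

(** By induction, beta q is dominated by a convex combination of the previous beta q and of |b|,
    with weights 1 - beta gamma and beta gamma; both are at most [Gb]. *)
Lemma q_norm i t : (0 < t)%N -> beta t.+1 * enorm (q i t) <= Gb.
Proof.
elim: t => // -[_ _|t IH _].
  by rewrite (alg_q1 alg) enorm0 mulr0.
apply: le_trans (_ : beta t.+2 * enorm (q i t.+2) <= _).
  by rewrite ler_wpM2r ?enorm_ge0 // beta_noninc.
have bg := beta_gamma (ltn0Sn t.+1); have b0 := beta_gt0 (ltn0Sn t.+1).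
have g0 := gamma_gt0 (ltn0Sn t.+1); have bn := b_norm i (ltn0Sn t).
have {}IH := IH isT.
have : enorm (q i t.+2) <=
    (1 - beta t.+2 * gamma t.+2) * enorm (q i t.+1) + gamma t.+2 * enorm (b i t.+1).
  rewrite (alg_q alg) //; apply: le_trans (enorm_pospart _) _.
  apply: le_trans (enormD _ _) _; rewrite !enormZ (ger0_norm (ltW g0)) ger0_norm //.
  by rewrite subr_ge0.
rewrite -(ler_pM2l b0) => /le_trans; apply.
apply: le_trans (_ : (1 - beta t.+2 * gamma t.+2) * Gb + beta t.+2 * gamma t.+2 * Gb <= _); last by lra.
rewrite mulrDr mulrCA [_ * (gamma _ * _)]mulrA; apply: lerD; first by rewrite ler_wpM2l // subr_ge0.
by rewrite ler_wpM2l // mulr_ge0 // ltW.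
Qed.

(** Taking positive parts does not increase the norm, so |q_{t+1}| <= |q + gamma (b - beta q)|.
    Expand the square and use |b - beta q| <= 2 Gb. *)
Lemma queue_step i t : (0 < t)%N ->
  (enorm (q i t.+1) ^+ 2 - enorm (q i t) ^+ 2) / (2 * gamma t.+1)
    + beta t.+1 * enorm (q i t) ^+ 2 - 2 * gamma t.+1 * Gb ^+ 2 <= dot (q i t) (b i t).
Proof.
move=> t0; have b0 := beta_gt0 (ltn0Sn t); have g0 := gamma_gt0 (ltn0Sn t).
rewrite lerBlDr -lerBrDr ler_pdivrMr; last by lra.
have le1 : enorm (q i t.+1) <= enorm (q i t + gamma t.+1 *: (b i t - beta t.+1 *: q i t)).
  rewrite (alg_q alg) //; apply: le_trans (enorm_pospart _) _.
  rewrite le_eqVlt; apply/orP; left; apply/eqP; congr enorm.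
  rewrite scalerBl scale1r scalerBr scalerA -/(b i t) -addrA; congr (_ + _).
  by rewrite addrC mulrC.
have le2 : enorm (q i t.+1) ^+ 2 <= enorm (q i t) ^+ 2
    + 2 * gamma t.+1 * (dot (q i t) (b i t) - beta t.+1 * enorm (q i t) ^+ 2)
    + gamma t.+1 ^+ 2 * enorm (b i t - beta t.+1 *: q i t) ^+ 2.
  move: le1; rewrite -(@ler_pXn2r _ 2) ?nnegrE ?enorm_ge0 // => /le_trans; apply.
  rewrite (enormD_sqr (q i t)) dotZr dotBr dotZr -!enorm_sqr enormZ exprMn real_normK ?num_real //.
  by lra.
have le3 : enorm (b i t - beta t.+1 *: q i t) ^+ 2 <= 4 * Gb ^+ 2.
  have : enorm (b i t - beta t.+1 *: q i t) <= 2 * Gb.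
    apply: le_trans (enormB _ _) _; rewrite enormZ gtr0_norm //.
    by have := q_norm i t0; have := b_norm i t0; lra.
  by have := enorm_ge0 (b i t - beta t.+1 *: q i t); nra.
have : gamma t.+1 ^+ 2 * enorm (b i t - beta t.+1 *: q i t) ^+ 2 <= gamma t.+1 ^+ 2 * (4 * Gb ^+ 2).
  by rewrite ler_wpM2l ?sqr_ge0.
by lra.
Qed.

(** Split x_{t+1} - y at x_t. Convexity gives the loss gap; since q >= 0 and [g(y)]_+ = 0, the
    subgradient inequality for [g]_+ turns the constraint part into <q, b>. *)
Lemma omega_lower i t y : (0 < t)%N -> X y -> vle0 (g i t y) ->
  f i t (x i t) - f i t y - F2 * enorm (x i t.+1 - x i t) + dot (q i t) (b i t)
  <= dot (x i t.+1 - y) (omega i t.+1).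
Proof.
move=> t0 Xy gy; rewrite (alg_omega alg) // (dotC (_ - y)).
have -> : x i t.+1 - y = (x i t.+1 - x i t) - (y - x i t) by rewrite opprB addrA subrK.
rewrite dotBr !dotDl.
have h1 : dot (df i t (x i t)) (y - x i t) <= f i t y - f i t (x i t).
  have := a1_df A1 i t0 (x_mem i t0) Xy; rewrite -/(dot _ _); lra.
have h2 : - (F2 * enorm (x i t.+1 - x i t)) <= dot (df i t (x i t)) (x i t.+1 - x i t).
  rewrite lerNl -dotNr; apply: le_trans (dot_le _ _) _.
  by rewrite enormN ler_wpM2r ?enorm_ge0 // (a1_df_bounded A1) //; exact: x_mem.
have h3 u : dot (dgp i t (x i t) *m q i t) u = dot (q i t) ((D i t)^T *m u).
  by rewrite dotC dot_mulmx dotC.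
have h4 : dot (q i t) ((D i t)^T *m (y - x i t)) <= - dot (q i t) (pospart (g i t (x i t))).
  rewrite -dotNr !dotE; apply: ler_sum => k _; rewrite ler_wpM2l ?q_ge0 //.
  have := dgp_le k t0 (x_mem i t0) Xy; have -> : pospart (g i t y) k 0 = 0.
    by rewrite mxE; apply/max_idPr; exact: gy.
  by move=> h; rewrite [leRHS]mxE; lra.
by rewrite !h3 /b dotDr; lra.
Qed.

Lemma agent_step i t y : (0 < t)%N -> X y -> vle0 (g i t y) ->
  f i t (x i t) - f i t y
    + ((enorm (q i t.+1) ^+ 2 - enorm (q i t) ^+ 2) / (2 * gamma t.+1)
       + beta t.+1 * enorm (q i t) ^+ 2)
    + enorm (x i t.+1 - z i t.+1) ^+ 2 / (2 * alpha t.+1)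
  <= 2 * Gb ^+ 2 * gamma t.+1 + F2 * enorm (x i t.+1 - x i t)
    + (enorm (z i t.+1 - y) ^+ 2 - enorm (x i t.+1 - y) ^+ 2) / (2 * alpha t.+1).
Proof.
move=> t0 Xy gy; have := queue_step i t0; have := omega_lower t0 Xy gy.
have a0 := alpha_gt0 (ltn0Sn t).
(* The projection inequality bounds this inner product from above: on expanding both squares, the
   terms in alpha^2 |omega|^2 cancel. *)
suff : dot (x i t.+1 - y) (omega i t.+1) <= (enorm (z i t.+1 - y) ^+ 2
    - enorm (x i t.+1 - y) ^+ 2 - enorm (x i t.+1 - z i t.+1) ^+ 2) / (2 * alpha t.+1).
  by rewrite [X in _ <= X -> _]mulrBl; lra.
rewrite ler_pdivlMr; last by lra.
have := eproj_three_point (z i t.+1 - alpha t.+1 *: omega i t.+1)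
  (a1_convex A1) (a1_closed A1) (a1_bounded A1) Xy.
rewrite -(alg_x alg) // ![_ - alpha t.+1 *: _ - _]addrAC.
rewrite (enormB_sqr (z i t.+1 - y)) (enormB_sqr (z i t.+1 - x i t.+1)) !dotZr (enormBC (z i t.+1) (x i t.+1)).
have -> : x i t.+1 - y = (z i t.+1 - y) - (z i t.+1 - x i t.+1).
  by rewrite opprB addrCA addrAC subrr add0r addrC.
by rewrite !dotBl; lra.
Qed.


(** * Summation over agents and time *)

Local Notation eps := (displacement x z).
Local Notation d := (disagreement x).

Let W_ge0 t i j : (0 < t)%N -> 0 <= W t i j.
Proof. by move=> t0; have [] := a2_stochastic A2 t0. Qed.

Let W_row t i : (0 < t)%N -> \sum_(j < n) W t i j = 1.
Proof. by move=> t0; have [] := a2_stochastic A2 t0. Qed.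

Let W_col t j : (0 < t)%N -> \sum_(i < n) W t i j = 1.
Proof. by move=> t0; have [] := a2_stochastic A2 t0. Qed.

Lemma d_le t : (0 < t)%N -> d t <= 2 * RX.
Proof.
move=> t0; apply: diam_le => [|i j]; first by have := a1_RX A1; lra.
by apply: dist_le; exact: x_mem.
Qed.

Lemma move_le i t : (0 < t)%N -> enorm (x i t.+1 - x i t) <= eps i t + tau t + d t.
Proof.
move=> t0; apply: le_trans (enorm_triangle (z i t.+1) _ _) _.
rewrite -addrA lerD2l (alg_z alg) // (avg_subr (W_row i t0)).
apply: enorm_avg_le => [j||j]; [exact: W_ge0 | exact: W_row |].
apply: le_trans (enorm_triangle (x j t) _ _) _; apply: lerD; first exact: xhat_near.
exact: (diam_ge (fun i => x i t)).
Qed.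

(** The iterates follow exact averaging of the x_j up to a perturbation r of norm at most eps + tau:
    the projected step plus the error of the broadcast values. *)
Lemma sum_d_le T :
  \sum_(1 <= t < T.+1) d t <=
    consensus_const n B w *
    (4 * RX + 2 * (\sum_(1 <= t < T.+1) tau t + \sum_(1 <= t < T.+1) \sum_(i < n) eps i t)).
Proof.
have RX0 := a1_RX A1.
pose r t i := x i t.+1 - mix (W t) (fun i => x i t) i.
have rec t i : (0 < t)%N -> x i t.+1 = mix (W t) (fun i => x i t) i + r t i.
  by move=> _; rewrite addrC subrK.
have r_le t i : (0 < t)%N -> enorm (r t i) <= eps i t + tau t.
  move=> t0; apply: le_trans (enorm_triangle (z i t.+1) _ _) _.
  rewrite lerD2l (alg_z alg) // /mix -sumrB.
  under eq_bigr do rewrite -scalerBr.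
  apply: enorm_avg_le => [j||j]; [exact: W_ge0 | exact: W_row | exact: xhat_near].
have r_bounded t i : (0 < t)%N -> enorm (r t i) <= 2 * RX.
  move=> t0; rewrite /r -enormN opprB (avg_subr (W_row i t0)).
  apply: enorm_avg_le => [j||j]; [exact: W_ge0 | exact: W_row |].
  by apply: dist_le; exact: x_mem.
apply: le_trans (sum_diam_le n_gt0 mixing A2 rec (M := 4 * RX) T _ _) _.
- by move=> t t0; have := d_le t0; rewrite /disagreement; lra.
- move=> t t0; apply: diam_le => [|i j]; first by lra.
  apply: le_trans (enormB _ _) _.
  by have := r_bounded t i t0; have := r_bounded t j t0; lra.
rewrite ler_wpM2l //.
  by rewrite divr_ge0 ?sqr_ge0 // addr_ge0 ?sqr_ge0 // ler0n.
rewrite lerD2l -big_split mulr_sumr /= big_nat [leRHS]big_nat ler_sum // => t /andP[t0 _].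
apply: diam_le => [|i j].
  by rewrite mulr_ge0 // addr_ge0 ?sumr_ge0 ?ltW ?tau_gt0 // => i _; exact: enorm_ge0.
apply: le_trans (enormB _ _) _; apply: le_trans (lerD (r_le t i t0) (r_le t j t0)) _.
have eps_le k : eps k t <= \sum_(i < n) eps i t.
  by rewrite (bigD1 k) //= lerDl sumr_ge0 // => l _; exact: enorm_ge0.
by have := eps_le i; have := eps_le j; lra.
Qed.

(** Jensen uses that rows sum to one; after exchanging the sums, columns summing to one remove the
    weights. Replacing xhat by x costs 6 RX tau. *)
Lemma z_sqr_sum t y : (0 < t)%N -> X y ->
  \sum_(i < n) enorm (z i t.+1 - y) ^+ 2 <=
  \sum_(i < n) enorm (x i t - y) ^+ 2 + n%:R * (6 * RX * tau t).
Proof.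
move=> t0 Xy.
apply: le_trans (_ : \sum_(i < n) \sum_(j < n) W t i j * enorm (xhat j t - y) ^+ 2 <= _).
  apply: ler_sum => i _; rewrite (alg_z alg) // (avg_subr (W_row i t0)).
  by apply: enorm_avg_sqr => [j|]; [exact: W_ge0 | exact: W_row].
rewrite exchange_big /=; under eq_bigr do rewrite -mulr_suml W_col // mul1r.
rewrite mulr_natl -[n in _ *+ n]card_ord -sumr_const -big_split /=.
apply: ler_sum => j _; apply: le_trans (sqr_dist_shift (xhat_mem j t0) (x_mem j t0) Xy) _.
rewrite lerD2l ler_wpM2l ?xhat_near //.
by have := a1_RX A1; lra.
Qed.

(** The drift telescopes except for the growth of 1/gamma, which is at most beta and so consumes
    half of the penalty beta |q|^2. *)
Lemma queue_sum i T :
  enorm (q i T.+1) ^+ 2 / (2 * gamma T.+1)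
    + \sum_(1 <= t < T.+1) beta t.+1 * enorm (q i t) ^+ 2 / 2 <=
  \sum_(1 <= t < T.+1)
    ((enorm (q i t.+1) ^+ 2 - enorm (q i t) ^+ 2) / (2 * gamma t.+1)
       + beta t.+1 * enorm (q i t) ^+ 2).
Proof.
elim: T => [|T IH]; first by rewrite !big_geq // (alg_q1 alg) enorm0 expr0n mul0r addr0.
rewrite big_nat_recr //= [leRHS]big_nat_recr //=.
have g1 := gamma_gt0 (ltn0Sn T); have g2 := gamma_gt0 (ltn0Sn T.+1).
have : enorm (q i T.+1) ^+ 2 * ((gamma T.+2)^-1 - (gamma T.+1)^-1) <= enorm (q i T.+1) ^+ 2 * beta T.+2.
  by rewrite ler_wpM2l ?sqr_ge0 // gamma_inv.
by move: IH; rewrite !invfM; lra.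
Qed.

Lemma regret_sum T (y : nat -> 'cV[R]_p) : (0 < T)%N ->
  (forall t, (0 < t <= T)%N -> X (y t) /\ forall i, vle0 (g i t (y t))) ->
  \sum_(1 <= t < T.+1) \sum_(i < n) (f i t (x i t) - f i t (y t))
    + \sum_(i < n) enorm (q i T.+1) ^+ 2 / (2 * gamma T.+1)
    + \sum_(1 <= t < T.+1) \sum_(i < n) beta t.+1 * enorm (q i t) ^+ 2 / 2
    + \sum_(1 <= t < T.+1) \sum_(i < n) eps i t ^+ 2 / (2 * alpha t.+1)
  <= n%:R * (2 * Gb ^+ 2 * \sum_(1 <= t < T.+1) gamma t.+1)
    + F2 * \sum_(1 <= t < T.+1) \sum_(i < n) enorm (x i t.+1 - x i t)
    + n%:R * (2 * RX ^+ 2 + 3 * RX * path_length y T) / alpha T.+1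
    + n%:R * (3 * RX * \sum_(1 <= t < T.+1) tau t / alpha t.+1).
Proof.
move=> T0 yP; have RX0 := a1_RX A1.
have sumc c : \sum_(i < n) c = n%:R * c :> R by rewrite sumr_const card_ord mulr_natl.
pose A t := \sum_(i < n) enorm (x i t - y t) ^+ 2.
pose A' t := \sum_(i < n) enorm (x i t.+1 - y t) ^+ 2.
pose a t := (2 * alpha t.+1)^-1.
have a0 t : (0 < t)%N -> 0 <= a t.
  by move=> t0; rewrite invr_ge0 mulr_ge0 // ltW // alpha_gt0.
have step t : (0 < t <= T)%N ->
    \sum_(i < n) (f i t (x i t) - f i t (y t))
    + \sum_(i < n) ((enorm (q i t.+1) ^+ 2 - enorm (q i t) ^+ 2) / (2 * gamma t.+1)
       + beta t.+1 * enorm (q i t) ^+ 2)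
    + \sum_(i < n) eps i t ^+ 2 / (2 * alpha t.+1)
    <= n%:R * (2 * Gb ^+ 2 * gamma t.+1) + F2 * (\sum_(i < n) enorm (x i t.+1 - x i t))
    + a t * (A t - A' t) + n%:R * (3 * RX * (tau t / alpha t.+1)).
  move=> tT; have [Xy gy] := yP t tT; have t0 : (0 < t)%N by lia.
  apply: le_trans (_ : n%:R * (2 * Gb ^+ 2 * gamma t.+1)
      + F2 * (\sum_(i < n) enorm (x i t.+1 - x i t))
      + a t * (\sum_(i < n) enorm (z i t.+1 - y t) ^+ 2 - A' t) <= _).
    rewrite -sumc mulr_sumr -sumrB mulr_sumr.
    rewrite -!big_split /=; apply: ler_sum => i _.
    have := agent_step t0 Xy (gy i).
    by rewrite -/(eps i t) [(_ - _) / (2 * alpha _)]mulrC -/(a t) mulrA; lra.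
  rewrite -!addrA lerD2l lerD2l.
  have -> : n%:R * (3 * RX * (tau t / alpha t.+1)) = a t * (n%:R * (6 * RX * tau t)).
    by rewrite /a invfM; field; rewrite gt_eqF ?alpha_gt0.
  rewrite -mulrDr ler_wpM2l ?a0 //.
  by have := z_sqr_sum t0 Xy; rewrite -/(A t); lra.
(* M = n (2 RX)^2 bounds the summed squared distances, and each move of the comparator costs 6 RX
   times its length per agent. *)
have abel := @sum_abel_le R a A A' (fun t => n%:R * (6 * RX * enorm (y t.+1 - y t)))
  (n%:R * (2 * RX) ^+ 2) T T0 a0.
have {abel} : \sum_(1 <= t < T.+1) a t * (A t - A' t) <=
    n%:R * (2 * RX ^+ 2 + 3 * RX * path_length y T) / alpha T.+1.
  apply: le_trans (_ : \sum_(1 <= t < T.+1) a t * (A t - A' t) + a T * A' T <= _).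
    by rewrite lerDl mulr_ge0 ?a0 // sumr_ge0 // => i _; exact: sqr_ge0.
  have M_bound t t' : (0 < t')%N -> (0 < t <= T)%N ->
      \sum_(i < n) enorm (x i t' - y t) ^+ 2 <= n%:R * (2 * RX) ^+ 2.
    move=> t'0 tT; have [Xy _] := yP t tT.
    rewrite -sumc; apply: ler_sum => i _.
    by have := dist_le (x_mem i t'0) Xy; have := enorm_ge0 (x i t' - y t); nra.
  apply: le_trans (abel _ _ _ _) _.
  - by move=> t t0; rewrite lef_pV2 ?posrE ?mulr_gt0 ?alpha_gt0 // ler_pM2l // alpha_noninc.
  - by move=> t; rewrite !mulr_ge0 ?enorm_ge0 // ltW.
  - by move=> t tT; split; apply: M_bound => //; lia.
  - move=> t tT; have [Xy _] := yP t ltac:(lia); have [Xy' _] := yP t.+1 ltac:(lia).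
    rewrite -sumc -big_split /=.
    apply: ler_sum => i _; rewrite enormBC (enormBC (x i t.+1) (y t)).
    by apply: sqr_dist_shift => //; exact: x_mem.
  rewrite /path_length -mulr_sumr -mulr_sumr le_eqVlt; apply/orP; left; apply/eqP.
  by rewrite /a; field; rewrite gt_eqF ?alpha_gt0.
have := ler_sum_nat (m := 1) (n := T.+1) (fun t tT => step t tT).
have : \sum_(i < n) enorm (q i T.+1) ^+ 2 / (2 * gamma T.+1)
    + \sum_(1 <= t < T.+1) \sum_(i < n) beta t.+1 * enorm (q i t) ^+ 2 / 2 <=
    \sum_(1 <= t < T.+1) \sum_(i < n)
      ((enorm (q i t.+1) ^+ 2 - enorm (q i t) ^+ 2) / (2 * gamma t.+1)
       + beta t.+1 * enorm (q i t) ^+ 2).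
  rewrite exchange_big [leRHS]exchange_big -big_split /=.
  by apply: ler_sum => i _; exact: queue_sum.
rewrite !big_split /= -!mulr_sumr; lra.
Qed.


(** * Absorbing the displacements and passing to the network metrics *)

Local Notation K := (consensus_const n B w).

Let K_ge0 : 0 <= K.
Proof. by rewrite divr_ge0 ?sqr_ge0 // addr_ge0 ?sqr_ge0 // ler0n. Qed.

Lemma sum_move_le T :
  \sum_(1 <= t < T.+1) \sum_(i < n) enorm (x i t.+1 - x i t) <=
  \sum_(1 <= t < T.+1) \sum_(i < n) eps i t
    + n%:R * (cumul tau T + \sum_(1 <= t < T.+1) d t).
Proof.
rewrite /cumul -big_split /= mulr_sumr -big_split /=; apply: ler_sum_nat => t /andP[t0 _].
rewrite mulr_natl -[n in _ *+ n]card_ord -sumr_const -big_split /=.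
by apply: ler_sum => i _; rewrite addrA; exact: move_le.
Qed.

(** AM-GM applied to each displacement with weight l / alpha. *)
Lemma sum_eps_le (l : R) T : 0 < l ->
  \sum_(1 <= t < T.+1) \sum_(i < n) eps i t <=
  2 * l * \sum_(1 <= t < T.+1) \sum_(i < n) eps i t ^+ 2 / (2 * alpha t.+1)
    + n%:R / (4 * l) * \sum_(1 <= t < T.+1) alpha t.+1.
Proof.
move=> l0; rewrite !mulr_sumr -big_split /=; apply: ler_sum => t _.
have -> : n%:R / (4 * l) * alpha t.+1 = \sum_(i < n) alpha t.+1 / (4 * l).
  by rewrite sumr_const card_ord -[RHS]mulr_natl; ring.
rewrite mulr_sumr -big_split /=; apply: ler_sum => i _.
have a0 := alpha_gt0 (ltn0Sn t).
apply: le_trans (le_scaled_sqr (eps i t) (divr_gt0 l0 a0)) _.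
rewrite le_eqVlt; apply/orP; left; apply/eqP.
by field; rewrite !gt_eqF.
Qed.

Local Notation c_eps := (F2 + 4 * n%:R * F2 * K).

Let c_eps_gt0 : 0 < c_eps.
Proof. apply: ltr_pwDl; first exact: a1_F2 A1. by rewrite mulr_ge0 // ?mulr_ge0. Qed.

(** The displacements enter with coefficient [c_eps]: F2 from the moves, and 2K times n F2 twice,
    once from the disagreement inside the moves and once from the disagreement term added on the
    left. *)
Lemma regret_core T (y : nat -> 'cV[R]_p) : (0 < T)%N ->
  (forall t, (0 < t <= T)%N -> X (y t) /\ forall i, vle0 (g i t (y t))) ->
  \sum_(1 <= t < T.+1) \sum_(i < n) (f i t (x i t) - f i t (y t))
    + n%:R * F2 * \sum_(1 <= t < T.+1) d t
    + \sum_(i < n) enorm (q i T.+1) ^+ 2 / (2 * gamma T.+1)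
    + \sum_(1 <= t < T.+1) \sum_(i < n) beta t.+1 * enorm (q i t) ^+ 2 / 2
    + (\sum_(1 <= t < T.+1) \sum_(i < n) eps i t ^+ 2 / (2 * alpha t.+1)) / 2
  <= n%:R * (2 * Gb ^+ 2) * \sum_(1 <= t < T.+1) gamma t.+1
    + n%:R * c_eps ^+ 2 * \sum_(1 <= t < T.+1) alpha t.+1
    + n%:R * F2 * (1 + 4 * K) * cumul tau T + 8 * n%:R * F2 * K * RX
    + n%:R * (2 * RX ^+ 2 + 3 * RX * path_length y T) / alpha T.+1
    + n%:R * (3 * RX) * \sum_(1 <= t < T.+1) tau t / alpha t.+1.
Proof.
move=> T0 yP; have RS := regret_sum T0 yP; have n0 : 0 <= n%:R :> R by [].
have F2D := ler_wpM2l (mulr_ge0 n0 F2_ge0) (sum_d_le T).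
have F2M := ler_wpM2l F2_ge0 (sum_move_le T).
have EPS : c_eps * \sum_(1 <= t < T.+1) \sum_(i < n) eps i t <=
    (\sum_(1 <= t < T.+1) \sum_(i < n) eps i t ^+ 2 / (2 * alpha t.+1)) / 2
    + n%:R * c_eps ^+ 2 * \sum_(1 <= t < T.+1) alpha t.+1.
  (* This weight makes c_eps * 2l equal to 1/2, so exactly half of the displacement energy is
     spent. *)
  have l0 : 0 < (4 * c_eps)^-1 by rewrite invr_gt0 mulr_gt0.
  apply: le_trans (ler_wpM2l (ltW c_eps_gt0) (sum_eps_le T l0)) _.
  rewrite le_eqVlt; apply/orP; left; apply/eqP.
  by field; rewrite gt_eqF.
move: RS F2D F2M EPS; rewrite -/(cumul tau T).
set SE := \sum_(1 <= t < T.+1) \sum_(i < n) eps i t.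
by lra.
Qed.

(** By the subgradient inequality, evaluating f_j at x_i instead of x_j costs at most F2 times the
    disagreement. *)
Lemma net_reg_le T (y : nat -> 'cV[R]_p) :
  n%:R * net_reg f x y T <=
  \sum_(1 <= t < T.+1) \sum_(i < n) (f i t (x i t) - f i t (y t))
    + n%:R * F2 * \sum_(1 <= t < T.+1) d t.
Proof.
have n0 : n%:R != 0 :> R by rewrite pnatr_eq0 -lt0n.
have sumc c : \sum_(i < n) c = n%:R * c :> R by rewrite sumr_const card_ord mulr_natl.
rewrite /net_reg mulrBr mulVKf // exchange_big /= !mulr_sumr -sumrB -big_split /=.
apply: ler_sum_nat => t /andP[t0 _]; rewrite sumrB.
rewrite [X in _ - X <= _]mulVKf // [leRHS]addrAC lerD2r.
have le i : global_loss f t (x i t) <=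
    n%:R^-1 * (\sum_(j < n) f j t (x j t) + n%:R * F2 * d t).
  rewrite ler_wpM2l ?invr_ge0 // -mulrA -sumc -big_split /=; apply: ler_sum => j _.
  have := a1_df A1 j t0 (x_mem i t0) (x_mem j t0); rewrite -/(dot _ _).
  have := dot_le (- df j t (x i t)) (x j t - x i t).
  rewrite dotNl enormN.
  have := a1_df_bounded A1 j t0 (x_mem i t0).
  have := diam_ge (fun i => x i t) j i; rewrite -/(d t).
  have := enorm_ge0 (x j t - x i t); have := enorm_ge0 (df j t (x i t)).
  have := F2_ge0.
  set e := enorm (df _ _ _); set c := enorm (_ - _); set c' := dot _ _.
  move=> F0 e0 c0 cd eF H H'.
  have : e * c <= F2 * d t by apply: ler_pM.
  by lra.
apply: le_trans (ler_sum _ (fun i _ => le i)) _.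
by rewrite sumc mulVKf.
Qed.

(** Dropping the outer positive part of the update gives b <= (q_{t+1} - q_t) / gamma + beta q in
    each coordinate. Since 1/gamma is nondecreasing and q >= 0, the sum of the differences is at
    most the last term. *)
Lemma violation_sum i T :
  \sum_(1 <= t < T.+1) enorm (pospart (g i t (x i t))) <=
  (m i)%:R * (enorm (q i T.+1) / gamma T.+1
    + \sum_(1 <= t < T.+1) beta t.+1 * enorm (q i t)
    + F2 * \sum_(1 <= t < T.+1) enorm (x i t.+1 - x i t)).
Proof.
have sumc c : \sum_(k < m i) c = (m i)%:R * c :> R by rewrite sumr_const card_ord mulr_natl.
apply: le_trans (_ : \sum_(1 <= t < T.+1) \sum_(k < m i) pospart (g i t (x i t)) k 0 <= _).
  apply: ler_sum => t _; apply: le_trans (enorm_le_l1 _) _.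
  by apply: ler_sum => k _; rewrite ger0_norm ?pospart_ge0.
rewrite exchange_big /= -sumc; apply: ler_sum => k _.
have q_le t : (0 < t)%N -> q i t k 0 <= enorm (q i t).
  by move=> t0; apply: le_trans (ler_norm _) (enorm_coord _ k).
apply: le_trans (_ : q i T.+1 k 0 / gamma T.+1 + \sum_(1 <= t < T.+1) beta t.+1 * q i t k 0
    + F2 * \sum_(1 <= t < T.+1) enorm (x i t.+1 - x i t) <= _); last first.
  rewrite lerD2r lerD //.
    by rewrite ler_wpM2r ?q_le // invr_ge0 ltW ?gamma_gt0.
  by apply: ler_sum_nat => t /andP[t0 _]; rewrite ler_wpM2l ?q_le // ltW ?beta_gt0.
elim: T => [|T IH].
  by rewrite !big_geq // mulr0 !addr0 divr_ge0 ?q_ge0 // ltW ?gamma_gt0.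
rewrite big_nat_recr //= [in leRHS]big_nat_recr //= [X in F2 * X]big_nat_recr //=.
have g1 := gamma_gt0 (ltn0Sn T); have g2 := gamma_gt0 (ltn0Sn T.+1).
have b2 := beta_gt0 (ltn0Sn T.+1).
have gV : q i T.+1 k 0 / gamma T.+1 <= q i T.+1 k 0 / gamma T.+2.
  by rewrite ler_wpM2l ?q_ge0 // lef_pV2 ?posrE // gamma_noninc.
have b_le : pospart (g i T.+1 (x i T.+1)) k 0 - F2 * enorm (x i T.+2 - x i T.+1) <= b i T.+1 k 0.
  rewrite /b [leRHS]mxE lerD2l lerNl; apply: le_trans (ler_norm _) _; rewrite normrN.
  apply: le_trans (enorm_coord _ _) _; apply: dgp_tr_norm => //; exact: x_mem.
have : b i T.+1 k 0 <= q i T.+2 k 0 / gamma T.+2 - q i T.+1 k 0 / gamma T.+2 + beta T.+2 * q i T.+1 k 0.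
  rewrite -(ler_pM2l g2); have : (1 - beta T.+2 * gamma T.+2) * q i T.+1 k 0
      + gamma T.+2 * b i T.+1 k 0 <= q i T.+2 k 0.
    rewrite (alg_q alg i (ltn0Sn T)); apply: le_trans _ (pospart_ge _ _ _).
    by rewrite [leRHS]mxE; apply: lerD; rewrite [leRHS]mxE.
  have -> : gamma T.+2 * (q i T.+2 k 0 / gamma T.+2 - q i T.+1 k 0 / gamma T.+2 + beta T.+2 * q i T.+1 k 0)
    = q i T.+2 k 0 - q i T.+1 k 0 + gamma T.+2 * beta T.+2 * q i T.+1 k 0.
    by field; rewrite gt_eqF.
  by lra.
by move: IH; lra.
Qed.


(** Linearising g_j at x_i shows that [g_j(x_i)]_+ exceeds [g_j(x_j)]_+ by at most F2 times the
    disagreement in norm, so only each agent's own violation remains to be summed. *)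
Lemma net_ccv_le T :
  net_ccv g x T <=
  (\sum_(i < n) m i)%:R *
    (\sum_(i < n) enorm (q i T.+1) / gamma T.+1
     + \sum_(1 <= t < T.+1) \sum_(i < n) beta t.+1 * enorm (q i t)
     + F2 * \sum_(1 <= t < T.+1) \sum_(i < n) enorm (x i t.+1 - x i t))
  + n%:R * F2 * \sum_(1 <= t < T.+1) d t.
Proof.
have n0 : n%:R != 0 :> R by rewrite pnatr_eq0 -lt0n.
have sumc c : \sum_(i < n) c = n%:R * c :> R by rewrite sumr_const card_ord mulr_natl.
apply: le_trans (_ : \sum_(1 <= t < T.+1) (\sum_(j < n) enorm (pospart (g j t (x j t)))
    + n%:R * F2 * d t) <= _).
  rewrite /net_ccv exchange_big /= mulr_sumr; apply: ler_sum_nat => t /andP[t0 _].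
  have le i : enorm (pospart (global_constraint g t (x i t))) <=
      \sum_(j < n) enorm (pospart (g j t (x j t))) + n%:R * F2 * d t.
    apply: le_trans (enorm_pospart_mxcol _) _.
    rewrite -mulrA -sumc -big_split /=; apply: ler_sum => j _.
    set u := (dgp j t (x i t))^T *m (x j t - x i t).
    have u_le : enorm u <= F2 * d t.
      apply: le_trans (dgp_tr_norm j _ t0 (x_mem i t0)) _; rewrite ler_wpM2l //.
      exact: (diam_ge (fun i => x i t)).
    apply: le_trans (_ : enorm (pospart (g j t (x j t)) - u) <= _).
      apply: pospart_mono => k; apply: le_trans (ler_norm _).
      have := dgp_le k t0 (x_mem i t0) (x_mem j t0); rewrite -/u.
      move=> h; rewrite [leRHS]mxE [X in _ + X]mxE; lra.
    by apply: le_trans (enormB _ _) _; rewrite lerD2l.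
  apply: le_trans (ler_wpM2l _ (ler_sum _ (fun i _ => le i))) _; first by rewrite invr_ge0.
  by rewrite sumc mulKf.
rewrite big_split /= -mulr_sumr lerD2r exchange_big /=.
rewrite [X in _ + X + _]exchange_big [X in F2 * X]exchange_big /=.
rewrite [F2 * _]mulr_sumr -!big_split /= mulr_sumr.
apply: ler_sum => i _; apply: le_trans (violation_sum i T) _.
rewrite ler_wpM2r //.
  rewrite !addr_ge0 ?divr_ge0 ?enorm_ge0 ?(ltW (gamma_gt0 _)) //.
    by rewrite big_nat sumr_ge0 // => t /andP[t0 _]; rewrite mulr_ge0 ?enorm_ge0 // ltW ?beta_gt0.
  by rewrite mulr_ge0 // sumr_ge0 // => t _; exact: enorm_ge0.
by rewrite ler_nat (bigD1 i) //= leq_addr.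
Qed.

End Run.

(** * Rates *)

(** Named forms of the step sizes, convertible to the functions of the theorem, to which the results
    for general steps are applied. *)
Definition sqrt_average (R : realType) (tau : nat -> R) (t : nat) : R :=
  Num.sqrt (cumul tau t / t%:R).

Definition inv_pow (R : realType) (k : R) (t : nat) : R := 1 / t%:R `^ k.

Ltac nonneg := repeat first [done | exact: sqr_ge0 | exact: sqrtr_ge0 | exact: ler0n
  | rewrite invr_ge0 | apply: addr_ge0 | apply: mulr_ge0].

Section Rates.
Context (R : realType) (n p : nat) (m : 'I_n -> nat) (X : set 'cV[R]_p)
  (f : 'I_n -> nat -> 'cV[R]_p -> R)
  (g : forall i : 'I_n, nat -> 'cV[R]_p -> 'cV[R]_(m i))
  (df : 'I_n -> nat -> 'cV[R]_p -> 'cV[R]_p)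
  (dg dgp : forall i : 'I_n, nat -> 'cV[R]_p -> 'M[R]_(p, m i))
  (E : nat -> rel 'I_n) (W : nat -> 'M[R]_n)
  (RX F1 F2 w : R) (B : nat) (tau : nat -> R) (kappa : R).
Hypotheses (n_gt0 : (0 < n)%N) (mixing : mixing_matrices E W)
  (A1 : assumption1 X f g df dg dgp RX F1 F2) (A2 : assumption2 E W w B)
  (A3 : assumption3 tau) (tau_gt0 : forall t : nat, (0 < t)%N -> 0 < tau t)
  (kappa01 : 0 < kappa < 1).

Local Notation Psi := (cumul tau).
Local Notation alpha := (sqrt_average tau).
Local Notation beta := (inv_pow kappa).
Local Notation gamma := (inv_pow (1 - kappa)).
Local Notation K := (consensus_const n B w).
Local Notation run := (algorithm1 X g df dgp W alpha beta gamma tau).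
Local Notation regret x y T :=
  (\sum_(1 <= t < T.+1) \sum_(i < n) (f i t (x i t) - f i t (y t))).
Local Notation total_disagreement x T := (\sum_(1 <= t < T.+1) disagreement x t).
Local Notation last_queue q T := (\sum_(i < n) enorm (q i T.+1) ^+ 2 / (2 * gamma T.+1)).
Local Notation queue_energy q T :=
  (\sum_(1 <= t < T.+1) \sum_(i < n) beta t.+1 * enorm (q i t) ^+ 2 / 2).
Local Notation displacement_energy x z T :=
  (\sum_(1 <= t < T.+1) \sum_(i < n) displacement x z i t ^+ 2 / (2 * alpha t.+1)).

Let k0 : 0 < kappa. Proof. by case/andP: kappa01. Qed.
Let k1 : kappa < 1. Proof. by case/andP: kappa01. Qed.
Let k0' : 0 <= kappa. Proof. exact: ltW. Qed.
Let l0 : 0 <= 1 - kappa. Proof. by rewrite subr_ge0 ltW. Qed.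
Let l1 : 1 - kappa < 1. Proof. by rewrite ltrBlDr ltrDl. Qed.
Let RX0 : 0 < RX := a1_RX A1.
Let F1_gt0 : 0 < F1 := a1_F1 A1.
Let F2_gt0 : 0 < F2 := a1_F2 A1.
Let tau1 : 0 < tau 1%N. Proof. exact: tau_gt0. Qed.
Let K0 : 0 <= consensus_const n B w.
Proof. by rewrite divr_ge0 ?sqr_ge0 // addr_ge0 ?sqr_ge0 // ler0n. Qed.

Let RX_ge0 : 0 <= RX. Proof. exact: ltW. Qed.
Let F1_ge0 : 0 <= F1. Proof. exact: ltW. Qed.
Let F2_ge0 : 0 <= F2. Proof. exact: ltW. Qed.
Let tau1_ge0 : 0 <= tau 1%N. Proof. exact: ltW. Qed.

Let alpha_pos t : (0 < t)%N -> 0 < alpha t. Proof. exact: alpha_gt0. Qed.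
Let alpha_dec t : (0 < t)%N -> alpha t.+1 <= alpha t. Proof. exact: alpha_noninc. Qed.
Let beta_pos t : (0 < t)%N -> 0 < beta t. Proof. exact: inv_powR_gt0. Qed.
Let beta_dec t : (0 < t)%N -> beta t.+1 <= beta t. Proof. exact: inv_powR_noninc. Qed.
Let gamma_pos t : (0 < t)%N -> 0 < gamma t. Proof. exact: inv_powR_gt0. Qed.
Let gamma_dec t : (0 < t)%N -> gamma t.+1 <= gamma t. Proof. exact: inv_powR_noninc. Qed.

Let beta_gamma t : (0 < t)%N -> beta t * gamma t <= 1.
Proof.
move=> t0; apply: mulr_ile1; try exact/ltW/inv_powR_gt0; exact: inv_powR_le1.
Qed.

Let gamma_inv t : (0 < t)%N -> (gamma t.+1)^-1 - (gamma t)^-1 <= beta t.+1.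
Proof. by move=> t0; rewrite /inv_pow !invf_div !divr1; apply: powR_increment_le => //; exact: ltW. Qed.

(** The queue and displacement energies are kept on the left: the regret bound discards them, and
    the violation bound needs them. *)
Lemma drift_bound : exists2 C : R, 0 < C &
  forall x xhat z omega q, run x xhat z omega q ->
  forall T y, (0 < T)%N -> feasible_seqs X g T y ->
  regret x y T + n%:R * F2 * total_disagreement x T + last_queue q T + queue_energy q T
    + displacement_energy x z T / 2 <=
  C * (T%:R `^ kappa + Num.sqrt (Psi T * T%:R) + Num.sqrt ((Psi T)^-1 * T%:R) * path_length y T).
Proof.
pose G := F1 + 2 * F2 * RX; pose c := F2 + 4 * n%:R * F2 * K.
(* C1, C2 and C3 collect the coefficients of T^kappa, sqrt(Psi_T T) and the path-length term. The
   additive constant joins C1 because T^kappa >= 1. *)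
pose C1 := n%:R * (2 * G ^+ 2) * (2 / kappa) + 8 * n%:R * F2 * K * RX.
pose C2 := n%:R * c ^+ 2 * 2 + n%:R * F2 * (1 + 4 * K) * Num.sqrt (tau 1%N)
  + n%:R * (4 * RX ^+ 2) * (tau 1%N)^-1 + n%:R * (3 * RX) * 4.
pose C3 := n%:R * (6 * RX).
have n0 : 0 <= n%:R :> R by [].
have C1_ge0 : 0 <= C1 by rewrite /C1; nonneg.
have C2_ge0 : 0 <= C2 by rewrite /C2; nonneg.
have C3_ge0 : 0 <= C3 by rewrite /C3; nonneg.
exists (C1 + C2 + C3 + 1); first by lra.
move=> x xhat z omega q alg T y T0 yT.
have yP t : (0 < t <= T)%N -> X (y t) /\ forall i, vle0 (g i t (y t)).
  by move=> /yT[Xy gy]; split=> // i; exact: (vle0_mxcol (v := fun i => g i t (y t)) gy).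
apply: le_trans (regret_core n_gt0 mixing A1 A2 tau_gt0 alpha_pos alpha_dec beta_pos beta_dec
  gamma_pos beta_gamma gamma_inv alg T0 yP) _.
rewrite -/G -/c.
set P := path_length y T; set k := T%:R `^ kappa; set u := Num.sqrt (Psi T * T%:R).
set v := Num.sqrt (_^-1 * _).
have P0 : 0 <= P by rewrite sumr_ge0 // => t _; exact: enorm_ge0.
have kge1 : 1 <= k by apply: nat_powR_ge1.
have u0 : 0 <= u by exact: sqrtr_ge0.
have v0 : 0 <= v by exact: sqrtr_ge0.
have hG : n%:R * (2 * G ^+ 2) * \sum_(1 <= t < T.+1) gamma t.+1 <= n%:R * (2 * G ^+ 2) * (2 / kappa * k).
  apply: ler_wpM2l; first by nonneg.
  by have := sum_inv_powR l0 l1 T0; rewrite subKr.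
have hA : n%:R * c ^+ 2 * \sum_(1 <= t < T.+1) alpha t.+1 <= n%:R * c ^+ 2 * (2 * u).
  by apply: ler_wpM2l; [nonneg | exact: sum_alpha].
have hP : n%:R * F2 * (1 + 4 * K) * Psi T <= n%:R * F2 * (1 + 4 * K) * (Num.sqrt (tau 1%N) * u).
  by apply: ler_wpM2l; [nonneg | exact: cumul_le_sqrt].
have hK : 8 * n%:R * F2 * K * RX <= 8 * n%:R * F2 * K * RX * k.
  by rewrite ler_peMr //; nonneg.
have hI : n%:R * (2 * RX ^+ 2 + 3 * RX * P) / alpha T.+1 <= n%:R * (2 * RX ^+ 2 + 3 * RX * P) * (2 * v).
  by apply: ler_wpM2l; [nonneg | exact: alpha_inv_last].
have hv : n%:R * (4 * RX ^+ 2) * v <= n%:R * (4 * RX ^+ 2) * ((tau 1%N)^-1 * u).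
  by apply: ler_wpM2l; [nonneg | exact: sqrt_inv_cumul_le].
have ht : n%:R * (3 * RX) * \sum_(1 <= t < T.+1) tau t / alpha t.+1 <= n%:R * (3 * RX) * (4 * u).
  by apply: ler_wpM2l; [nonneg | exact: sum_tau_alpha].
apply: le_trans (_ : C1 * k + C2 * u + C3 * (v * P) <= _).
  by rewrite /C1 /C2 /C3; lra.
have vP0 : 0 <= v * P by rewrite mulr_ge0.
by rewrite !mulrDr; apply: lerD; [apply: lerD|]; apply: ler_wpM2r => //; lra.
Qed.

Let energies_ge0 (x z : 'I_n -> nat -> 'cV[R]_p) (q : forall i : 'I_n, nat -> 'cV[R]_(m i)) T :
  [/\ 0 <= last_queue q T, 0 <= queue_energy q T & 0 <= displacement_energy x z T].
Proof.
split.
- apply: sumr_ge0 => i _; rewrite divr_ge0 ?sqr_ge0 // mulr_ge0 // ltW //; exact: gamma_pos.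
- apply: sumr_ge0 => t _; apply: sumr_ge0 => i _.
  rewrite divr_ge0 // mulr_ge0 ?sqr_ge0 // ltW //; exact: beta_pos.
- apply: sumr_ge0 => t _; apply: sumr_ge0 => i _.
  rewrite divr_ge0 ?sqr_ge0 // mulr_ge0 // ltW //; exact: alpha_pos.
Qed.

Lemma net_reg_rate : exists (C : R) (T0 : nat), 0 < C /\
  forall x xhat z omega q, run x xhat z omega q ->
  forall T, (0 < T)%N -> (T0 <= T)%N -> forall y, feasible_seqs X g T y ->
  net_reg f x y T <=
    C * (T%:R `^ kappa + Num.sqrt (Psi T * T%:R)
         + Num.sqrt ((Psi T)^-1 * T%:R) * path_length y T).
Proof.
have [C C0 CP] := drift_bound; have n0 : 0 < n%:R :> R by rewrite ltr0n.
exists (n%:R^-1 * C), 0%N; split; first by rewrite mulr_gt0 ?invr_gt0.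
move=> x xhat z omega q alg T T0 _ y yT.
rewrite -mulrA -ler_pdivrMl ?invr_gt0 // invrK.
apply: le_trans (CP _ _ _ _ _ alg T y T0 yT).
apply: le_trans (net_reg_le n_gt0 A1 alg T y) _.
by have [] := energies_ge0 x z q T; lra.
Qed.

Lemma sum_last_queue_le (l : R) (q : forall i : 'I_n, nat -> 'cV[R]_(m i)) T : 0 < l ->
  \sum_(i < n) enorm (q i T.+1) / gamma T.+1 <=
  2 * l * last_queue q T + n%:R / (4 * l) * T.+1%:R `^ (1 - kappa).
Proof.
move=> l_gt0; have g0 := gamma_pos (ltn0Sn T).
have -> : n%:R / (4 * l) * T.+1%:R `^ (1 - kappa) = \sum_(i < n) (4 * l)^-1 / gamma T.+1.
  by rewrite sumr_const card_ord -[RHS]mulr_natl /inv_pow invf_div divr1; ring.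
rewrite mulr_sumr -big_split /=; apply: ler_sum => i _.
have -> : 2 * l * (enorm (q i T.+1) ^+ 2 / (2 * gamma T.+1)) + (4 * l)^-1 / gamma T.+1 =
    (l * enorm (q i T.+1) ^+ 2 + (4 * l)^-1) / gamma T.+1.
  by field; rewrite !gt_eqF.
by rewrite ler_pM2r ?invr_gt0 // le_scaled_sqr.
Qed.

Lemma sum_queue_le (l : R) (q : forall i : 'I_n, nat -> 'cV[R]_(m i)) T : 0 < l ->
  \sum_(1 <= t < T.+1) \sum_(i < n) beta t.+1 * enorm (q i t) <=
  2 * l * queue_energy q T + n%:R / (4 * l) * \sum_(1 <= t < T.+1) beta t.+1.
Proof.
move=> l_gt0; rewrite !mulr_sumr -big_split /=; apply: ler_sum => t _.
have b0 := beta_pos (ltn0Sn t).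
have -> : n%:R / (4 * l) * beta t.+1 = \sum_(i < n) beta t.+1 * (4 * l)^-1.
  by rewrite sumr_const card_ord -[RHS]mulr_natl; ring.
rewrite mulr_sumr -big_split /=; apply: ler_sum => i _.
have -> : 2 * l * (beta t.+1 * enorm (q i t) ^+ 2 / 2) + beta t.+1 * (4 * l)^-1 =
    beta t.+1 * (l * enorm (q i t) ^+ 2 + (4 * l)^-1) by field; rewrite gt_eqF.
by rewrite ler_pM2l // le_scaled_sqr.
Qed.

(** A static comparator has zero path length and the regret is at least - n F1 T, so the drift bound
    makes each energy linear in T. The factor 2 undoes the halved displacement energy. *)
Lemma energy_bound (static_feasible_nonempty :
    forall T : nat, (0 < T)%N -> static_feasible_seqs X g T !=set0) :
  exists2 M : R, 0 <= M &
  forall x xhat z omega q, run x xhat z omega q -> forall T, (0 < T)%N ->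
  [/\ last_queue q T <= M * T%:R, queue_energy q T <= M * T%:R &
      displacement_energy x z T <= 2 * M * T%:R].
Proof.
have [C C0 CP] := drift_bound.
exists (C * (1 + Num.sqrt (tau 1%N)) + n%:R * F1).
  by have := ltW C0 => C_ge0; nonneg.
move=> x xhat z omega q alg T T0.
have [y0 [v [Xv vT]]] := static_feasible_nonempty T T0.
have yT : feasible_seqs X g T (fun=> v) by move=> t /vT[].
have := CP _ _ _ _ _ alg T _ T0 yT.
have -> : path_length (fun=> v) T = 0.
  by rewrite /path_length big1 // => t _; rewrite subrr enorm0.
rewrite mulr0 addr0.
have regT : - (n%:R * F1 * T%:R) <= regret x (fun=> v) T.
  have -> : - (n%:R * F1 * T%:R) = \sum_(1 <= t < T.+1) \sum_(i < n) - F1.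
    under eq_bigr do rewrite sumr_const card_ord.
    rewrite sumr_const_nat subSS subn0 -[RHS]mulr_natl -mulr_natl; ring.
  apply: ler_sum_nat => t /andP[t0 _]; apply: ler_sum => i _.
  by have := a1_f_bounded A1 i t0 (x_mem A1 alg i t0) Xv; rewrite ler_norml => /andP[].
have D0 : 0 <= n%:R * F2 * total_disagreement x T.
  by rewrite !mulr_ge0 // sumr_ge0 // => t _; exact: diam_ge0.
have kT : C * T%:R `^ kappa <= C * T%:R by rewrite ler_pM2l // ler1_powR ?ler1n // ltW.
have uT : C * Num.sqrt (Psi T * T%:R) <= C * (Num.sqrt (tau 1%N) * T%:R).
  have -> : Num.sqrt (tau 1%N) * T%:R = Num.sqrt (tau 1%N * T%:R * T%:R).
    by rewrite -mulrA -expr2 sqrtrM // sqrtr_sqr ger0_norm.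
  by rewrite ler_pM2l // ler_wsqrtr // ler_wpM2r // cumul_ub.
have [] := energies_ge0 x z q T.
move=> h1 h2 h3 H; split; lra.
Qed.

Lemma net_ccv_rate (static_feasible_nonempty :
    forall T : nat, (0 < T)%N -> static_feasible_seqs X g T !=set0) :
  exists (C : R) (T0 : nat), 0 < C /\
  forall x xhat z omega q, run x xhat z omega q ->
  forall T, (0 < T)%N -> (T0 <= T)%N ->
  net_ccv g x T <= C * (T%:R `^ (1 - kappa / 2) + (Psi T * T%:R ^+ 3) `^ (1 / 4)).
Proof.
have [M M0 MP] := energy_bound static_feasible_nonempty.
pose mm : R := (\sum_(i < n) m i)%:R.
have n0 : 0 <= n%:R :> R by []; have mm0 : 0 <= mm by exact: ler0n.
(* The constants bound, in order, the queue terms, the displacements, Psi_T, the disagreement and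
   the moves. *)
pose c1 := 4 * M + n%:R / 2 + n%:R / (2 * (1 - kappa)).
pose c2 := 4 * M + n%:R / 2.
pose c3 := Num.sqrt (tau 1%N) * Num.sqrt (Num.sqrt (tau 1%N)).
pose c4 := K * (4 * RX + 2 * (c3 + c2)).
have c2_ge0 : 0 <= c2 by rewrite /c2; nonneg.
have c1_ge0 : 0 <= c1 by rewrite /c1; nonneg.
have c3_ge0 : 0 <= c3 by rewrite /c3; nonneg.
have c4_ge0 : 0 <= c4 by rewrite /c4; nonneg.
pose c5 := c2 + n%:R * (c3 + c4).
have c5_ge0 : 0 <= c5 by rewrite /c5; nonneg.
exists (mm * (c1 + F2 * c5) + n%:R * F2 * c4 + 1), 0%N; split.
  by apply: ltr_wpDl => //; nonneg.
move=> x xhat z omega q alg T T0 _.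
have Tpos : 0 < T%:R :> R by rewrite ltr0n.
set V := T%:R `^ (1 - kappa / 2); set Y := (_ `^ (1 / 4)).
have V1 : 1 <= V by apply: nat_powR_ge1 => //; have := k1; lra.
have Y0 : 0 <= Y by exact: powR_ge0.
have [QT QQ EE] := MP _ _ _ _ _ alg T T0.
(* Cauchy-Schwarz, as AM-GM with weight l, for the queues *)
pose l : R := T%:R `^ (- (kappa / 2)).
have l_gt0 : 0 < l by exact: nat_powR_gt0.
have lT : l * T%:R = V.
  rewrite -[X in l * X](powRr1 (ltW Tpos)) -powRD ?(gt_eqF Tpos) ?implybT //.
  by congr (_ `^ _); ring.
have Tl : T%:R `^ (1 - kappa) / l = V.
  rewrite -powRN opprK -powRD ?(gt_eqF Tpos) ?implybT //.
  by congr (_ `^ _); field.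
have hQ : \sum_(i < n) enorm (q i T.+1) / gamma T.+1
    + \sum_(1 <= t < T.+1) \sum_(i < n) beta t.+1 * enorm (q i t) <= c1 * V.
  have h1 := sum_last_queue_le q T l_gt0; have h2 := sum_queue_le q T l_gt0.
  have h3 : 2 * l * last_queue q T <= 2 * l * (M * T%:R) by rewrite ler_pM2l // mulr_gt0.
  have h4 : 2 * l * queue_energy q T <= 2 * l * (M * T%:R) by rewrite ler_pM2l // mulr_gt0.
  have nl : 0 <= n%:R / (4 * l) by rewrite divr_ge0 // mulr_ge0 // ltW.
  have h5 := ler_wpM2l nl (powR_double l0 (ltW l1) T0).
  have h6 := ler_wpM2l nl (sum_inv_powR k0' k1 T0).
  have -> : c1 * V = 2 * l * (M * T%:R) + 2 * l * (M * T%:R)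
      + n%:R / (4 * l) * (2 * T%:R `^ (1 - kappa))
      + n%:R / (4 * l) * (2 / (1 - kappa) * T%:R `^ (1 - kappa)).
    rewrite -[2 * l * _]mulrA [l * (M * _)]mulrCA lT /c1 -Tl.
    have k1n : 1 - kappa != 0 by rewrite gt_eqF // subr_gt0.
    by field; rewrite k1n gt_eqF.
  by move: h1 h2 h3 h4 h5 h6; rewrite /inv_pow; lra.
(* the same for the displacements, with weight a / b = (Psi_T / T)^(1/4) *)
pose a := Num.sqrt (Num.sqrt (Psi T)); pose b := Num.sqrt (Num.sqrt (T%:R : R)).
have a0 : 0 < a by rewrite !sqrtr_gt0 cumul_gt0.
have b0 : 0 < b by rewrite !sqrtr_gt0.
have aE : a ^+ 4 = Psi T by rewrite (exprM _ 2 2) !sqr_sqrtr ?sqrtr_ge0 ?cumul_ge0.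
have bE : b ^+ 4 = T%:R by rewrite (exprM _ 2 2) !sqr_sqrtr ?sqrtr_ge0 // ltW.
have uE : Num.sqrt (Psi T * T%:R) = a ^+ 2 * b ^+ 2.
  by rewrite -aE -bE (exprM _ 2 2) (exprM b 2 2) -exprMn sqrtr_sqr ger0_norm // mulr_ge0 ?sqr_ge0.
have YE : Y = a * b ^+ 3.
  have ab0 : 0 <= a * b ^+ 3 by rewrite mulr_ge0 ?exprn_ge0 // ltW.
  have -> : Y = ((a * b ^+ 3) `^ 4%:R) `^ (1 / 4).
    by rewrite powR_mulrn // /Y -aE -bE; congr (_ `^ _); ring.
  by rewrite -powRrM (_ : 4%:R * (1 / 4) = 1) ?powRr1 //; field.
have hS : \sum_(1 <= t < T.+1) \sum_(i < n) displacement x z i t <= c2 * Y.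
  have ab0 : 0 < a / b by rewrite divr_gt0.
  apply: le_trans (sum_eps_le alpha_pos x z T ab0) _.
  have h1 : 2 * (a / b) * displacement_energy x z T <= 2 * (a / b) * (2 * M * T%:R).
    by rewrite ler_pM2l // mulr_gt0.
  have nl : 0 <= n%:R / (4 * (a / b)) by rewrite divr_ge0 // mulr_ge0 // ltW.
  have h2 := ler_wpM2l nl (sum_alpha A3 tau_gt0 T).
  have -> : c2 * Y = 2 * (a / b) * (2 * M * T%:R)
      + n%:R / (4 * (a / b)) * (2 * Num.sqrt (Psi T * T%:R)).
    by rewrite YE uE -bE /c2; field; rewrite !gt_eqF.
  by apply: lerD h1 h2.
have hPsi : Psi T <= c3 * Y.
  apply: le_trans (cumul_le_sqrt A3 tau_gt0 T) _.
  rewrite /c3 -mulrA ler_wpM2l ?sqrtr_ge0 // uE YE.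
  have : a <= Num.sqrt (Num.sqrt (tau 1%N)) * b.
    rewrite -sqrtrM ?sqrtr_ge0 // ler_wsqrtr // -sqrtrM ?(ltW tau1) // ler_wsqrtr //.
    exact: cumul_ub.
  have ab : 0 <= a * b ^+ 2 by rewrite mulr_ge0 ?sqr_ge0 // ltW.
  by move/(ler_wpM2l ab); lra.
(* From here every contribution is compared with V + Y; since V >= 1, it also absorbs the constant 4
   RX of the disagreement. *)
have Y_le : Y <= V + Y by lra.
have hS' : \sum_(1 <= t < T.+1) \sum_(i < n) displacement x z i t <= c2 * (V + Y).
  exact: le_trans hS (ler_wpM2l c2_ge0 Y_le).
have hPsi' : Psi T <= c3 * (V + Y) by exact: le_trans hPsi (ler_wpM2l c3_ge0 Y_le).
have hQ' : \sum_(i < n) enorm (q i T.+1) / gamma T.+1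
    + \sum_(1 <= t < T.+1) \sum_(i < n) beta t.+1 * enorm (q i t) <= c1 * (V + Y).
  by apply: le_trans hQ (ler_wpM2l c1_ge0 _); lra.
have hD : total_disagreement x T <= c4 * (V + Y).
  apply: le_trans (sum_d_le n_gt0 mixing A1 A2 tau_gt0 alg T) _.
  rewrite -/(Psi T) /c4 -mulrA; apply: ler_wpM2l => //.
  have : 4 * RX * 1 <= 4 * RX * (V + Y) by rewrite ler_wpM2l ?mulr_ge0 ?(ltW RX0) //; lra.
  by move: hS' hPsi'; lra.
have hM : F2 * \sum_(1 <= t < T.+1) \sum_(i < n) enorm (x i t.+1 - x i t) <= F2 * (c5 * (V + Y)).
  rewrite ler_pM2l //; apply: le_trans (sum_move_le A2 tau_gt0 alg T) _.
  rewrite /c5 mulrDl -mulrA; apply: lerD => //; apply: ler_wpM2l => //.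
  by rewrite mulrDl lerD.
apply: le_trans (net_ccv_le n_gt0 A1 beta_pos gamma_pos gamma_dec alg T) _.
rewrite -/mm.
have h1 := ler_wpM2l mm0 (lerD hQ' hM).
have h2 := ler_wpM2l (mulr_ge0 n0 (ltW F2_gt0)) hD.
have VY : 0 <= V + Y by lra.
by move: h1 h2; lra.
Qed.

End Rates.

Theorem theorem1 (R : realType) (n p : nat) (m : 'I_n -> nat)
    (X : set 'cV[R]_p)
    (f : 'I_n -> nat -> 'cV[R]_p -> R)
    (g : forall i : 'I_n, nat -> 'cV[R]_p -> 'cV[R]_(m i))
    (df : 'I_n -> nat -> 'cV[R]_p -> 'cV[R]_p)
    (dg dgp : forall i : 'I_n, nat -> 'cV[R]_p -> 'M[R]_(p, m i))
    (E : nat -> rel 'I_n) (W : nat -> 'M[R]_n)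
    (RX F1 F2 w : R) (B : nat) (tau : nat -> R) (kappa : R)
    (Psi := cumul tau)
    (alpha := fun t : nat => Num.sqrt (Psi t / t%:R))
    (beta := fun t : nat => 1 / t%:R `^ kappa)
    (gamma := fun t : nat => 1 / t%:R `^ (1 - kappa))
    (n_gt0 : (0 < n)%N)
    (feasible_nonempty : forall T : nat, (0 < T)%N -> feasible_seqs X g T !=set0)
    (static_feasible_nonempty :
      forall T : nat, (0 < T)%N -> static_feasible_seqs X g T !=set0)
    (mixing : mixing_matrices E W)
    (A1 : assumption1 X f g df dg dgp RX F1 F2)
    (A2 : assumption2 E W w B)
    (A3 : assumption3 tau)
    (tau_gt0 : forall t : nat, (0 < t)%N -> 0 < tau t)
    (kappa01 : 0 < kappa < 1) :
  (exists (C : R) (T0 : nat), 0 < C /\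
    forall (x xhat z omega : 'I_n -> nat -> 'cV[R]_p)
           (q : forall i : 'I_n, nat -> 'cV[R]_(m i)),
    algorithm1 X g df dgp W alpha beta gamma tau x xhat z omega q ->
    forall T : nat, (0 < T)%N -> (T0 <= T)%N ->
    forall y : nat -> 'cV[R]_p, feasible_seqs X g T y ->
    net_reg f x y T <=
      C * (T%:R `^ kappa + Num.sqrt (Psi T * T%:R)
           + Num.sqrt ((Psi T)^-1 * T%:R) * path_length y T)) /\
  (exists (C : R) (T0 : nat), 0 < C /\
    forall (x xhat z omega : 'I_n -> nat -> 'cV[R]_p)
           (q : forall i : 'I_n, nat -> 'cV[R]_(m i)),
    algorithm1 X g df dgp W alpha beta gamma tau x xhat z omega q ->
    forall T : nat, (0 < T)%N -> (T0 <= T)%N ->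
    net_ccv g x T <=
      C * (T%:R `^ (1 - kappa / 2) + (Psi T * T%:R ^+ 3) `^ (1 / 4))).
Proof.
split.
- exact: (net_reg_rate n_gt0 mixing A1 A2 A3 tau_gt0 kappa01).
- exact: (net_ccv_rate n_gt0 mixing A1 A2 A3 tau_gt0 kappa01 static_feasible_nonempty).
Qed.
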